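(* For every non-zero $f\in K[x]_{\mu\text{-att}}$, one has $u_r(f)\in\Gamma_{r-1}$ and $$H_\mu(f)=x_r^{\,s_r(f)}\,p_r^{\,u_r(f)}\,R_r(f)(y_r)\quad\text{in }\mathcal G_\mu.$$
   Context: Let $(K,v)$ be a valued field with non-trivial value group $\Gamma$, residue field $k$, $\Gamma_{\mathbb Q}=\Gamma\otimes\mathbb Q$. For a valuation $\mu$ on $K[x]$: $\mathcal P_\alpha=\{g:\mu(g)\ge\alpha\}\supseteq\mathcal P^+_\alpha=\{g:\mu(g)>\alpha\}$, graded algebra $\mathcal G_\mu=\bigoplus_\alpha\mathcal P_\alpha/\mathcal P_\alpha^+$, $\Delta_\mu=\mathcal P_0/\mathcal P_0^+$, initial form $H_\mu(g)=g+\mathcal P^+_{\mu(g)}$ (multiplicative; extended multiplicatively to quotients); $h\mid_\mu g$ iff $H_\mu(h)\mid H_\mu(g)$. Key polynomial: monic $\phi$ with $H_\mu(\phi)\mathcal G_\mu$ non-zero prime and $\phi\nmid_\mu f$ for non-zero $f$ of smaller degree; $[\mu;\phi,\gamma](\sum a_s\phi^s)=\min(\mu(a_s)+s\gamma)$ for $\gamma>\mu(\phi)$. For $\mu\le\mu'$ in a chain, the canonical map $\mathcal G_\mu\to\mathcal G_{\mu'}$ sends $H_\mu(f)$ to $H_{\mu'}(f)$ if $\mu(f)=\mu'(f)$, else to $0$. MacLane chain $\mu_{-\infty}\xrightarrow{\phi_0,\gamma_0}\mu_0\to\cdots\xrightarrow{\phi_r,\gamma_r}\mu_r=\mu$: $\gamma_i\in\Gamma_{\mathbb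 Q}$, $\phi_0=x+a$, $\mu_0(\sum a_s\phi_0^s)=\min(v(a_s)+s\gamma_0)$, $\phi_i$ key polynomial for $\mu_{i-1}$, $\mu_i=[\mu_{i-1};\phi_i,\gamma_i]$, $\phi_{i+1}\nmid_{\mu_i}\phi_i$. $\mu_{-1}=v$, $\Gamma_{\mu_{-1}}=\Gamma$, $m_i=\deg\phi_i$, $e_i=(\Gamma_{\mu_i}:\Gamma_{\mu_{i-1}})$, $h_i=e_i\gamma_i\in\Gamma_{\mu_{i-1}}$. $\Delta_i=\Delta_{\mu_i}$; $\kappa_0$ = image of $k$ in $\Delta_0$, $\kappa_i$ = image of $\Delta_{i-1}\to\Delta_i$; one identifies $k=\kappa_0\subset\cdots\subset\kappa_r$, and $\Delta_i^*=\kappa_i^*$. Fix a finitely generated $\Gamma_{-1}\subseteq\Gamma$ with $h_i\in\Gamma_{-1}+\langle\gamma_0,\dots,\gamma_{i-1}\rangle$; $\Gamma_i=\langle\Gamma_{-1},\gamma_0,\dots,\gamma_i\rangle$ (free of rank $n$; $\Gamma_i\cap\Gamma_{\mu_{i-1}}=\Gamma_{i-1}$; $h_i\in\Gamma_{i-1}$). Bases: $\iota_{0,\cdot}$ of $\Gamma_{-1}$ fixed; recursively $\gamma_i=\sum_j(h_{i,j}/e_{i,j})\iota_{i,j}$ (coprime, $e_{i,j}>0$), $e'_{i,1}=d_{i,1}=1$, $e'_{i,j}=\prod_{t<j}e_{i,t}/\prod_{t<j}d_{i,t}$, $d_{i,j}=\gcd(e_{i,j},e'_{i,j})$, integers $\ell_{i,j}h_{i,j}e'_{i,j}+\ell'_{i,j}e_{i,j}=d_{i,j}$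 with $0\le\ell_{i,j}<e_{i,j}/d_{i,j}$, and $(\iota_{i+1,\cdot})=(\iota_{i,\cdot})Q_i$, $Q_i$ lower triangular, diagonal $d_{i,j}/e_{i,j}$, $(m,j)$-entry $\ell_{i,j}e'_{i,j}h_{i,m}/e_{i,m}$ ($m>j$); a basis of $\Gamma_i$. Rational functions: $\pi_{0,j}\in K^*$ with $v(\pi_{0,j})=\iota_{0,j}$; $\pi_{i+1,j}=(\phi_i\pi_{i,1}^{-h_{i,1}/e_{i,1}}\cdots\pi_{i,j-1}^{-h_{i,j-1}/e_{i,j-1}})^{\ell_{i,j}e'_{i,j}}\pi_{i,j}^{\ell'_{i,j}}$; $\pi_i^\alpha=\prod_j\pi_{i,j}^{n_j}$ for $\alpha=\sum n_j\iota_{i,j}\in\Gamma_{i-1}$; $Y_i=\phi_i^{e_i}\pi_i^{-h_i}$. Graded elements: $x_r=H_\mu(\phi_r)$, $y_r=H_\mu(Y_r)\in\Delta_\mu$, $p_r^\alpha=H_\mu(\pi_r^\alpha)\in\mathcal G_\mu^*$ for $\alpha\in\Gamma_{r-1}$. ($y_r$ is transcendental over $\kappa_r$ and $\Delta_\mu=\kappa_r[y_r]$.) Residual polynomial: for non-zero $f=\sum_sa_s\phi_r^s$ ($\deg a_s<m_r$), $N_r(f)$ is the lower convex hull in $\mathbb Q\times\Gamma_{\mathbb Q}$ of $Q_s=(s,\mu_{r-1}(a_s))$, $a_s\ne0$; $S_{\gamma_r}(f)$ is the set of $(s,u)\in N_r(f)$ minimizing $u+s\gamma_r$, with left endpoint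 $(s_r(f),u_r(f))$ and right endpoint $(s'_r(f),u'_r(f))$; $d=(s'_r(f)-s_r(f))/e_r\in\mathbb Z$, $s_j=s_r(f)+je_r$. $K[x]_{\mu\text{-att}}=\{0\}\cup\{g\ne0:\mu(g)\in\Gamma_r\}$. For non-zero $f\in K[x]_{\mu\text{-att}}$, $R_r(f)=\sum_{j=0}^dc_jy^j\in\kappa_r[y]$ with $c_j=p_r^{-\mu_{r-1}(a_{s_j})}H_\mu(a_{s_j})\in\kappa_r^*$ if $Q_{s_j}$ lies on $N_r(f)$ and $c_j=0$ otherwise; $R_r(0)=0$. *)

(* Defs.v *)
From HB Require Import structures.
From mathcomp Require Import all_boot all_order all_algebra.
From Stdlib Require Import ClassicalEpsilon.
Set Implicit Arguments. Unset Strict Implicit. Unset Printing Implicit Defensive.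
Import GRing.Theory.
Local Open Scope ring_scope.

(* Data of a MacLane chain over a valued field (K,v) whose values lie in the
   Q-vector space G = Gamma_Q (ordered by [le]).  Indices j of bases run over
   0 <= j < rk (the paper's 1 <= j <= n). *)
Record chain (K : fieldType) (G : lmodType rat) := Chain {
  le : rel G;
  val : K -> G;               (* v on K^* *)
  phi : nat -> {poly K};
  gam : nat -> G;
  eidx : nat -> nat;          (* e_i = (Gamma_{mu_i} : Gamma_{mu_{i-1}}) *)
  rk : nat;
  iota0 : nat -> G;           (* iota_{0,j} : basis of Gamma_{-1} *)
  pi0 : nat -> K;
  hh : nat -> nat -> int;
  ee : nat -> nat -> nat;
  ll : nat -> nat -> int;
  ll' : nat -> nat -> int
}.

Section Defs.
Variables (K : fieldType) (G : lmodType rat) (C : chain K G).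

Definition glt (a b : G) := le C a b && (a != b).
Definition gmin (a b : G) := if le C a b then a else b.
Definition gminl (s : seq G) : G := if s is a :: s' then foldr gmin a s' else 0.

(* phi-adic expansion f = sum_s a_s phi^s, deg a_s < deg phi (phi monic) *)
Fixpoint phiexp_rec (k : nat) (p f : {poly K}) : seq {poly K} :=
  if k is k'.+1 then (f %% p) :: phiexp_rec k' p (f %/ p) else [::].
Definition phiexp (p f : {poly K}) := phiexp_rec (size f) p f.
Definition coefs (p f : {poly K}) (s : nat) := nth 0 (phiexp p f) s.

(* augmented valuation [mu; p, g](sum a_s p^s) = min (mu(a_s) + s g)
   (only used on non-zero polynomials) *)
Definition augment (mu : {poly K} -> G) (p : {poly K}) (g : G) (f : {poly K}) : G :=
  gminl [seq mu (coefs p f s) + g *+ s | s <- iota 0 (size (phiexp p f)) & coefs p f s != 0].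

(* muc 0 = mu_{-1} = v (on constants); muc i.+1 = mu_i = [mu_{i-1}; phi_i, gamma_i];
   in particular mu_0 (sum a_s phi_0^s) = min (v(a_s) + s gamma_0). *)
Fixpoint muc (k : nat) : {poly K} -> G :=
  if k is k'.+1 then augment (muc k') (phi C k') (gam C k') else fun f => val C (f`_0).

(* An element of G_mu = (+)_alpha P_alpha/P_alpha^+ is represented by a finite
   formal sum of pairs (alpha, g) with g in P_alpha, standing for the sum of
   the classes g + P_alpha^+ ; [greq] is equality in G_mu. *)
Definition gr := seq (G * {poly K}).
Definition gzero : gr := [::].
Definition gone : gr := [:: (0, 1)].
Definition gadd (a b : gr) : gr := a ++ b.
Definition gmul (a b : gr) : gr := [seq (x.1 + y.1, x.2 * y.2) | x <- a, y <- b].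
Fixpoint gexp (a : gr) (n : nat) : gr := if n is n'.+1 then gmul a (gexp a n') else gone.
Definition gsum (l : seq gr) : gr := flatten l.

Section Mu.
Variable mu : {poly K} -> G.
Definition valid (a : gr) := all (fun x => (x.2 == 0) || le C x.1 (mu x.2)) a.
Definition comp (a : gr) (b : G) : {poly K} := \sum_(x <- a | x.1 == b) x.2.
Definition greq (a b : gr) : Prop :=
  forall g : G, comp a g - comp b g = 0 \/ glt g (mu (comp a g - comp b g)).
Definition Hmu (f : {poly K}) : gr := if f == 0 then gzero else [:: (mu f, f)].
Definition gdvd (a b : gr) := exists c, valid c /\ greq (gmul a c) b.
Definition gunit (a : gr) := gdvd a gone.
Definition nz_prime_elt (a : gr) :=
  ~ greq a gzero /\ ~ gunit a /\
  forall b c, valid b -> valid c -> gdvd a (gmul b c) -> gdvd a b \/ gdvd a c.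
Definition mu_div (h g : {poly K}) := gdvd (Hmu h) (Hmu g).
Definition key_poly (p : {poly K}) :=
  p \is monic /\ nz_prime_elt (Hmu p) /\
  forall f : {poly K}, f != 0 -> (size f < size p)%N -> ~ mu_div p f.
(* H_mu extended multiplicatively to quotients: H(g/h) = H(g) H(h)^{-1} *)
Definition Hfrac (q : {fraction {poly K}}) : gr :=
  epsilon (inhabits gzero) (fun z => valid z /\ exists g h : {poly K},
    h != 0 /\ q = FracField.tofrac g / FracField.tofrac h /\ greq (gmul z (Hmu h)) (Hmu g)).
End Mu.

Definition Gam (g : G) := exists a : K, a != 0 /\ val C a = g.
(* GamMu k = Gamma_{mu_{k-1}} *)
Definition GamMu (k : nat) (g : G) : Prop :=
  if k is k'.+1 then exists a b : {poly K}, a != 0 /\ b != 0 /\ g = muc k a - muc k b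
  else Gam g.
Definition index_is (A B : G -> Prop) (e : nat) :=
  exists b : nat -> G, (forall k, (k < e)%N -> B (b k)) /\
    (forall k l, (k < e)%N -> (l < e)%N -> A (b k - b l) -> k = l) /\
    (forall x, B x -> exists2 k, (k < e)%N & A (x - b k)).
(* GamIdx k = Gamma_{k-1} = < Gamma_{-1}, gamma_0, ..., gamma_{k-1} > *)
Definition GamIdx (k : nat) (g : G) : Prop :=
  exists c z : nat -> int,
    g = \sum_(j < rk C) iota0 C j *~ c j + \sum_(t < k) gam C t *~ z t.
Definition hbig (i : nat) : G := gam C i *+ eidx C i.

Fixpoint eprime (i j : nat) : nat :=
  if j is j'.+1 then eprime i j' * (ee C i j' %/ gcdn (ee C i j') (eprime i j'))
  else 1.
Definition dd (i j : nat) : nat := gcdn (ee C i j) (eprime i j).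
Definition Qcoef (i m j : nat) : rat :=
  if m == j then (dd i j)%:R / (ee C i j)%:R
  else if (j < m)%N then (ll C i j)%:~R * (eprime i j)%:R * (hh C i m)%:~R / (ee C i m)%:R
  else 0.
Fixpoint iotab (i j : nat) : G :=
  if i is i'.+1 then \sum_(m < rk C) Qcoef i' m j *: iotab i' m else iota0 C j.

Local Notation F := {fraction {poly K}}.
Local Notation tof := (@FracField.tofrac _).
(* pi_{i+1,j} = (phi_i pi_{i,1}^{-h_{i,1}/e_{i,1}} ... )^{l e'} pi_{i,j}^{l'};
   the exponent of pi_{i,t} is -(l_{i,j} (e'_{i,j}/e_{i,t}) h_{i,t}), e_{i,t} | e'_{i,j} *)
Fixpoint piF (i : nat) : nat -> F := fun j =>
  if i is i'.+1 then
    (tof (phi C i')) ^ (ll C i' j * (eprime i' j)%:Z) *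
    \prod_(t < j) (piF i' t) ^ (- (ll C i' j * ((eprime i' j) %/ (ee C i' t))%:Z * hh C i' t)) *
    (piF i' j) ^ (ll' C i' j)
  else tof ((pi0 C j)%:P).
Definition coords (i : nat) (a : G) : nat -> int :=
  epsilon (inhabits (fun _ : nat => (0 : int))) (fun c : nat -> int => a = \sum_(j < rk C) iotab i j *~ c j).
Definition pipow (i : nat) (a : G) : F := \prod_(j < rk C) piF i j ^ (coords i a j).
Definition Yr (i : nat) : F := (tof (phi C i)) ^+ eidx C i * pipow i (- hbig i).

(* ---------- graded elements at level r (mu = mu_r = muc r.+1) ----------- *)
Definition xr (r : nat) : gr := Hmu (muc r.+1) (phi C r).
Definition yr (r : nat) : gr := Hfrac (muc r.+1) (Yr r).
Definition pr (r : nat) (a : G) : gr := Hfrac (muc r.+1) (pipow r a).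

Definition npts (r : nat) (f : {poly K}) : seq (nat * G) :=
  [seq (s, muc r (coefs (phi C r) f s)) | s <- iota 0 (size (phiexp (phi C r) f))
     & coefs (phi C r) f s != 0].
Definition conv_pt (pts : seq (nat * G)) (t : rat) (w : G) : Prop :=
  exists lam : nat -> rat, (forall k, 0 <= lam k) /\
    \sum_(k < size pts) lam k = 1 /\
    t = \sum_(k < size pts) lam k * ((nth (0%N, 0) pts k).1)%:R /\
    w = \sum_(k < size pts) lam k *: (nth (0%N, 0) pts k).2.
(* (t,w) lies on N_r(f), the lower convex hull of the Q_s *)
Definition onN (r : nat) (f : {poly K}) (t : rat) (w : G) : Prop :=
  conv_pt (npts r f) t w /\ forall w', conv_pt (npts r f) t w' -> le C w w'.
Definition inS (r : nat) (f : {poly K}) (t : rat) (w : G) : Prop :=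
  onN r f t w /\ forall t' w', onN r f t' w' -> le C (w + t *: gam C r) (w' + t' *: gam C r).
Definition sL (r : nat) (f : {poly K}) : nat :=
  epsilon (inhabits 0%N) (fun s : nat =>
    (exists u, inS r f s%:R u) /\ forall t w, inS r f t w -> s%:R <= t).
Definition uL (r : nat) (f : {poly K}) : G :=
  epsilon (inhabits 0) (fun u => inS r f (sL r f)%:R u).
Definition sR (r : nat) (f : {poly K}) : nat :=
  epsilon (inhabits 0%N) (fun s : nat =>
    (exists u, inS r f s%:R u) /\ forall t w, inS r f t w -> t <= s%:R).

Definition Rcoef (r : nat) (f : {poly K}) (j : nat) : gr :=
  let s := (sL r f + j * eidx C r)%N in
  let a := coefs (phi C r) f s in
  if excluded_middle_informative (a != 0 /\ onN r f s%:R (muc r a)) then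
    gmul (pr r (- muc r a)) (Hmu (muc r.+1) a)
  else gzero.
Definition Rres (r : nat) (f : {poly K}) : seq gr :=
  [seq Rcoef r f j | j <- iota 0 ((sR r f - sL r f) %/ eidx C r).+1].
Definition Reval (c : seq gr) (y : gr) : gr :=
  gsum [seq gmul (nth gzero c j) (gexp y j) | j <- iota 0 (size c)].

Definition MacLane_setup (r : nat) : Prop :=
  [/\
      [/\ forall a, le C a a,
          forall a b c, le C a b -> le C b c -> le C a c,
          forall a b, le C a b -> le C b a -> a = b,
          forall a b, le C a b || le C b a &
          forall a b c, le C a b -> le C (a + c) (b + c)],
      (* v is a non-trivial valuation on K with values Gamma, Gamma_Q = Gamma (x) Q *)
      [/\ forall a b, a != 0 -> b != 0 -> val C (a * b) = val C a + val C b,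
          forall a b, a != 0 -> b != 0 -> a + b != 0 ->
                      le C (gmin (val C a) (val C b)) (val C (a + b)),
          exists a, a != 0 /\ val C a != 0 &
          forall g, exists2 n, (0 < n)%N & Gam (g *+ n)],
      [/\ exists a, phi C 0 = 'X + a%:P,
          forall i, (0 < i <= r)%N ->
             key_poly (muc i) (phi C i) /\ glt (muc i (phi C i)) (gam C i),
          forall i, (i < r)%N -> ~ mu_div (muc i.+1) (phi C i.+1) (phi C i) &
          forall i, (i <= r)%N ->
             (0 < eidx C i)%N /\ index_is (GamMu i) (GamMu i.+1) (eidx C i)],
      [/\ forall j, (j < rk C)%N -> Gam (iota0 C j),
          forall c : nat -> int, \sum_(j < rk C) iota0 C j *~ c j = 0 ->
             forall j, (j < rk C)%N -> c j = 0 &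
          forall i, (i <= r)%N -> GamIdx i (hbig i)] &
      [/\ forall i, (i < r)%N ->
             gam C i = \sum_(m < rk C) ((hh C i m)%:~R / (ee C i m)%:R) *: iotab i m,
          forall i j, (i < r)%N -> (j < rk C)%N ->
             (0 < ee C i j)%N /\ coprime `|hh C i j|%N (ee C i j),
          forall i j, (i < r)%N -> (j < rk C)%N ->
             [/\ ll C i j * hh C i j * (eprime i j)%:Z + ll' C i j * (ee C i j)%:Z
                   = (dd i j)%:Z,
                 0 <= ll C i j & ll C i j < ((ee C i j) %/ (dd i j))%:Z] &
          forall j, (j < rk C)%N -> pi0 C j != 0 /\ val C (pi0 C j) = iota0 C j]].

End Defs.

(* Main.v *)
Require Import Defs.
From HB Require Import structures.
From mathcomp Require Import all_boot all_order all_algebra.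
From mathcomp Require Import ring.
From Stdlib Require Import ClassicalEpsilon.
Set Implicit Arguments. Unset Strict Implicit. Unset Printing Implicit Defensive.
Import GRing.Theory.
Local Open Scope ring_scope.

(** The augmentation of a valuation by a key polynomial [phi] is a valuation
    because primality of the initial form of [phi] controls products of
    polynomials of degree less than [deg phi]; moreover the initial form of a
    polynomial that [phi] does not mu-divide becomes a unit, its inverse coming
    from a Bezout relation with [phi].  Hence the [phi_i] with [i < r], and
    with them all the [pi_r^alpha], are units of the graded algebra of [mu_r].

    The terms of least value in the [phi_r]-expansion of [f] are those on the
    side of slope [- gamma_r] of the Newton polygon.  Since the order of
    [gamma_r] modulo the value group of [mu_{r-1}] is [e_r], their abscissas are
    congruent to [s_r(f)] modulo [e_r], and each of them is rewritten through
    [pi_r^u pi_r^{- (u - j h_r)} pi_r^{- j h_r} = 1].  *)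

(** Elements of the graded algebra are formal sums compared up to higher value, and [Hfrac] is an
    arbitrary [epsilon] choice, so neither can be computed with directly. Each factor is therefore
    followed through one polynomial: [homogeneous a al p] makes [a] the class of [p] in degree [al],
    and [represents al q p] gives the fraction [q] the initial form of [p]. The theorem becomes one
    estimate: the difference of two explicit polynomials has value above mu(f). Negative powers are
    what requires units: the inverse of a fraction is followed by a polynomial only when its initial
    form has an inverse. The multiplicativity of alpha -> pi_r^alpha is not formal either, because
    the exponents [coords] are also chosen by [epsilon]. It rests on the [iotab r] spanning
    Gamma_{r-1} over the integers and being free over the rationals. The chain starts from [muc 0],
    which is v of the constant coefficient and not a valuation of K[x]; [augmentable] therefore
    speaks only of factors of degree below deg phi, so that x + a and key polynomials are treated
    alike. *)

Definition group_order (K : fieldType) (G : lmodType rat) (C : chain K G) :=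
  [/\ forall a, le C a a,
      forall a b c, le C a b -> le C b c -> le C a c,
      forall a b, le C a b -> le C b a -> a = b,
      forall a b, le C a b || le C b a &
      forall a b c, le C a b -> le C (a + c) (b + c)].

(** * The ordered group of values *)

Section Order.
Variables (K : fieldType) (G : lmodType rat) (C : chain K G).
Hypothesis oC : group_order C.
Implicit Types a b c d : G.

Lemma le_gg a : le C a a. Proof. by case: oC. Qed.

Lemma le_g_trans b a c : le C a b -> le C b c -> le C a c.
Proof. by case: oC => _ h _ _ _; apply: h. Qed.

Lemma le_g_anti a b : le C a b -> le C b a -> a = b.
Proof. by case: oC => _ _ h _ _; apply: h. Qed.

Lemma le_g_total a b : le C a b || le C b a.
Proof. by case: oC. Qed.

Lemma le_gD2r c a b : le C (a + c) (b + c) = le C a b.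
Proof.
have h x y z : le C x y -> le C (x + z) (y + z) by case: oC => _ _ _ _; apply.
by apply/idP/idP => [/(h _ _ (- c))|/h //]; rewrite !addrK.
Qed.

Lemma le_gD2l c a b : le C (c + a) (c + b) = le C a b.
Proof. by rewrite ![c + _]addrC le_gD2r. Qed.

Lemma glt_nge a b : glt C a b = ~~ le C b a.
Proof.
rewrite /glt; case: (boolP (le C b a)) => hba /=.
  by apply/negP => /andP[hab]; rewrite (le_g_anti hab hba) eqxx.
have := le_g_total a b; rewrite (negbTE hba) orbF => -> /=.
by apply: contraNneq hba => ->; apply: le_gg.
Qed.

Lemma gle_ngt a b : le C a b = ~~ glt C b a.
Proof. by rewrite glt_nge negbK. Qed.

Lemma gltW a b : glt C a b -> le C a b.
Proof. by case/andP. Qed.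

Lemma glt_gg a : glt C a a = false.
Proof. by rewrite glt_nge le_gg. Qed.

Lemma glt_le_trans b a c : glt C a b -> le C b c -> glt C a c.
Proof. by rewrite !glt_nge => h hbc; apply: contra h; apply: le_g_trans. Qed.

Lemma gle_lt_trans b a c : le C a b -> glt C b c -> glt C a c.
Proof. by rewrite !glt_nge => hab; apply: contra => hca; apply: le_g_trans hab. Qed.

Lemma glt_D2r c a b : glt C (a + c) (b + c) = glt C a b.
Proof. by rewrite !glt_nge le_gD2r. Qed.

Lemma glt_D2l c a b : glt C (c + a) (c + b) = glt C a b.
Proof. by rewrite !glt_nge le_gD2l. Qed.

Lemma le_gD a b c d : le C a b -> le C c d -> le C (a + c) (b + d).
Proof. by move=> hab hcd; apply: (@le_g_trans (b + c)); rewrite ?le_gD2r ?le_gD2l. Qed.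

Lemma glt_leD a b c d : glt C a b -> le C c d -> glt C (a + c) (b + d).
Proof.
by move=> hab hcd; apply: (@glt_le_trans (b + c)); rewrite ?glt_D2r ?le_gD2l.
Qed.

Lemma le_subgl a b c : le C (a - b) c = le C a (c + b).
Proof. by rewrite -(le_gD2r b) subrK. Qed.

Lemma glt_subgl a b c : glt C (a - b) c = glt C a (c + b).
Proof. by rewrite -(glt_D2r b) subrK. Qed.

Lemma le_g_mulrn n a : le C 0 a -> le C 0 (a *+ n).
Proof.
by move=> ha; elim: n => [|n IH]; rewrite ?le_gg // mulrS -[0]addr0 le_gD.
Qed.

Lemma glt_mulrn n a : (0 < n)%N -> glt C 0 a -> glt C 0 (a *+ n).
Proof.
case: n => // n _ ha; rewrite mulrS -[0]addr0 glt_leD //.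
exact/le_g_mulrn/gltW.
Qed.

Lemma le_gN2 a b : le C (- a) (- b) = le C b a.
Proof. by rewrite -(le_gD2r (a + b)) addKr addrCA addNr addr0. Qed.

Lemma glt_N2 a b : glt C (- a) (- b) = glt C b a.
Proof. by rewrite !glt_nge le_gN2. Qed.

Lemma mulrn_rat_eq0 n a : (0 < n)%N -> a *+ n = 0 -> a = 0.
Proof.
move=> n0 h; rewrite -[a]scale1r -(@mulVf _ (n%:R : rat)) ?Num.Theory.pnatr_eq0 -?lt0n //.
by rewrite -scalerA scaler_nat h scaler0.
Qed.

Lemma gminP a b : (gmin C a b = a /\ le C a b) \/ (gmin C a b = b /\ le C b a).
Proof.
rewrite /gmin; have := le_g_total a b.
by case: ifP => h /=; [left | right].
Qed.

Lemma gminl_in s : s != [::] -> gminl C s \in s.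
Proof.
case: s => // a s _ /=; elim: s => [|b s IH] /=; first by rewrite inE.
case: (gminP b (foldr (gmin C) a s)) => [] [-> _]; first by rewrite !inE eqxx orbT.
by move: IH; rewrite !inE => /orP[->|->]; rewrite ?orbT.
Qed.

Lemma gminl_le s x : x \in s -> le C (gminl C s) x.
Proof.
case: s => // a s /=; elim: s x => [|b s IH] x /=.
  by rewrite inE => /eqP ->; apply: le_gg.
have [hb hm] : le C (gmin C b (foldr (gmin C) a s)) b /\
               le C (gmin C b (foldr (gmin C) a s)) (foldr (gmin C) a s).
  by case: (gminP b (foldr (gmin C) a s)) => [] [-> h]; split=> //; apply: le_gg.
rewrite !inE => /or3P[/eqP->|/eqP->|h] //.
  by apply: (le_g_trans hm); apply: IH; rewrite inE eqxx.
by apply: (le_g_trans hm); apply: IH; rewrite inE h orbT.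
Qed.

End Order.

(** * Filtrations and valuations on polynomials *)

Section Filtration.
Variables (K : fieldType) (G : lmodType rat) (C : chain K G).
Hypothesis oC : group_order C.
Implicit Types (mu : {poly K} -> G) (al be : G) (f g : {poly K}).

(** [mu 0] is a meaningless default, so 0 is placed by hand in every piece of the filtration. *)
Definition Pge mu al f := (f == 0) || le C al (mu f).
Definition Pgt mu al f := (f == 0) || glt C al (mu f).

(** Stated at a single pair because for [muc 0] it is only available on constants. *)
Definition ultrametric_at mu f g :=
  f != 0 -> g != 0 -> f + g != 0 -> le C (gmin C (mu f) (mu g)) (mu (f + g)).

Definition valuation mu :=
  (forall f g, f != 0 -> g != 0 -> mu (f * g) = mu f + mu g) /\
  (forall f g, ultrametric_at mu f g).

Lemma Pge0 mu al : Pge mu al 0. Proof. by rewrite /Pge eqxx. Qed.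
Lemma Pgt0 mu al : Pgt mu al 0. Proof. by rewrite /Pgt eqxx. Qed.
Lemma Pge_nz mu al f : f != 0 -> Pge mu al f = le C al (mu f).
Proof. by rewrite /Pge => /negbTE ->. Qed.
Lemma Pgt_nz mu al f : f != 0 -> Pgt mu al f = glt C al (mu f).
Proof. by rewrite /Pgt => /negbTE ->. Qed.

Lemma Pge_refl mu f : Pge mu (mu f) f.
Proof. by rewrite /Pge le_gg ?orbT. Qed.

Lemma PgtW mu al f : Pgt mu al f -> Pge mu al f.
Proof. by rewrite /Pgt /Pge => /orP[->//|/gltW ->]; rewrite orbT. Qed.

Lemma Pge_mono mu al be f : le C al be -> Pge mu be f -> Pge mu al f.
Proof. by move=> h /orP[e|h']; rewrite /Pge ?e // (le_g_trans oC h h') orbT. Qed.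

Lemma Pge_Pgt mu al be f : glt C al be -> Pge mu be f -> Pgt mu al f.
Proof. by move=> h /orP[e|h']; rewrite /Pgt ?e // (glt_le_trans oC h h') orbT. Qed.

Lemma Pgt_mono mu al be f : le C al be -> Pgt mu be f -> Pgt mu al f.
Proof. by move=> h /orP[e|h']; rewrite /Pgt ?e // (gle_lt_trans oC h h') orbT. Qed.

Lemma value_eq mu al f : f != 0 -> Pge mu al f -> ~~ Pgt mu al f -> mu f = al.
Proof.
move=> f0; rewrite Pge_nz // Pgt_nz // => h; rewrite -gle_ngt // => h'.
exact: (le_g_anti oC h' h).
Qed.

Lemma PgeD_at mu al f g : ultrametric_at mu f g ->
  Pge mu al f -> Pge mu al g -> Pge mu al (f + g).
Proof.
move=> h hf hg; case: (eqVneq (f + g) 0) => [->|s0]; first exact: Pge0.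
case: (eqVneq f 0) => [->|f0]; first by rewrite add0r.
case: (eqVneq g 0) => [->|g0]; first by rewrite addr0.
move: hf hg; rewrite !Pge_nz // => hf hg; apply: (le_g_trans oC) (h f0 g0 s0).
by case: (gminP oC (mu f) (mu g)) => [] [-> _].
Qed.

Lemma PgtD_at mu al f g : ultrametric_at mu f g ->
  Pgt mu al f -> Pgt mu al g -> Pgt mu al (f + g).
Proof.
move=> h hf hg; case: (eqVneq (f + g) 0) => [->|s0]; first exact: Pgt0.
case: (eqVneq f 0) => [->|f0]; first by rewrite add0r.
case: (eqVneq g 0) => [->|g0]; first by rewrite addr0.
move: hf hg; rewrite !Pgt_nz // => hf hg; apply: (glt_le_trans oC) (h f0 g0 s0).
by case: (gminP oC (mu f) (mu g)) => [] [-> _].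
Qed.

Lemma ultrametric_of_Pge mu f g :
  (forall al, Pge mu al f -> Pge mu al g -> Pge mu al (f + g)) -> ultrametric_at mu f g.
Proof.
move=> h f0 g0 s0; rewrite -Pge_nz //; apply: h; rewrite Pge_nz //;
by case: (gminP oC (mu f) (mu g)) => [] [-> h] //; apply: le_gg.
Qed.

Section Valuation.
Variable mu : {poly K} -> G.
Hypothesis muV : valuation mu.

Lemma valuationM f g : f != 0 -> g != 0 -> mu (f * g) = mu f + mu g.
Proof. by case: muV => h _; apply: h. Qed.

Lemma valuation1 : mu 1 = 0.
Proof.
have := valuationM (oner_neq0 {poly K}) (oner_neq0 {poly K}).
by rewrite mulr1 => /eqP; rewrite -subr_eq subrr eq_sym => /eqP.
Qed.

Lemma valuationN1 : mu (- 1) = 0.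
Proof.
have h : (-1 : {poly K}) != 0 by rewrite oppr_eq0 oner_neq0.
by have := valuationM h h; rewrite mulrNN mulr1 valuation1 -mulr2n => /esym /mulrn_rat_eq0; apply.
Qed.

Lemma valuationN f : mu (- f) = mu f.
Proof.
case: (eqVneq f 0) => [->|f0]; first by rewrite oppr0.
by rewrite -mulN1r valuationM ?oppr_eq0 ?oner_neq0 // valuationN1 add0r.
Qed.

Lemma PgeN al f : Pge mu al (- f) = Pge mu al f.
Proof. by rewrite /Pge oppr_eq0 valuationN. Qed.
Lemma PgtN al f : Pgt mu al (- f) = Pgt mu al f.
Proof. by rewrite /Pgt oppr_eq0 valuationN. Qed.

Lemma PgeD al f g : Pge mu al f -> Pge mu al g -> Pge mu al (f + g).
Proof. by apply: PgeD_at; case: muV. Qed.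
Lemma PgtD al f g : Pgt mu al f -> Pgt mu al g -> Pgt mu al (f + g).
Proof. by apply: PgtD_at; case: muV. Qed.
Lemma PgeB al f g : Pge mu al f -> Pge mu al g -> Pge mu al (f - g).
Proof. by move=> hf hg; apply: PgeD; rewrite ?PgeN. Qed.
Lemma PgtB al f g : Pgt mu al f -> Pgt mu al g -> Pgt mu al (f - g).
Proof. by move=> hf hg; apply: PgtD; rewrite ?PgtN. Qed.
Lemma Pgt_subC al f g : Pgt mu al (f - g) = Pgt mu al (g - f).
Proof. by rewrite -PgtN opprB. Qed.

Lemma Pgt_sum (I : Type) (s : seq I) (P : pred I) (F : I -> {poly K}) al :
  (forall i, P i -> Pgt mu al (F i)) -> Pgt mu al (\sum_(i <- s | P i) F i).
Proof. by move=> h; apply: (big_ind (Pgt mu al)) => //; [apply: Pgt0 | move=> *; apply: PgtD]. Qed.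

Lemma PgeM al be f g : Pge mu al f -> Pge mu be g -> Pge mu (al + be) (f * g).
Proof.
case: (eqVneq f 0) => [->|f0]; first by move=> *; rewrite mul0r Pge0.
case: (eqVneq g 0) => [->|g0]; first by move=> *; rewrite mulr0 Pge0.
rewrite !Pge_nz ?mulf_neq0 // valuationM //; exact: le_gD.
Qed.

Lemma PgtMl al be f g : Pgt mu al f -> Pge mu be g -> Pgt mu (al + be) (f * g).
Proof.
case: (eqVneq f 0) => [->|f0]; first by move=> *; rewrite mul0r Pgt0.
case: (eqVneq g 0) => [->|g0]; first by move=> *; rewrite mulr0 Pgt0.
rewrite Pge_nz // !Pgt_nz ?mulf_neq0 // valuationM //; exact: glt_leD.
Qed.

Lemma PgtMr al be f g : Pge mu al f -> Pgt mu be g -> Pgt mu (al + be) (f * g).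
Proof. by move=> hf hg; rewrite addrC mulrC; apply: PgtMl. Qed.

Lemma Pgt_mulE al f g : f != 0 -> Pgt mu (mu f + al) (f * g) = Pgt mu al g.
Proof.
move=> f0; case: (eqVneq g 0) => [->|g0]; first by rewrite mulr0 !Pgt0.
by rewrite !Pgt_nz ?mulf_neq0 // valuationM // glt_D2l.
Qed.

Lemma Pge_mulE al f g : f != 0 -> Pge mu (mu f + al) (f * g) = Pge mu al g.
Proof.
move=> f0; case: (eqVneq g 0) => [->|g0]; first by rewrite mulr0 !Pge0.
by rewrite !Pge_nz ?mulf_neq0 // valuationM // le_gD2l.
Qed.

(** If [g] were 0 or of larger value, then [f], the sum of [f - g] and [g], would have a value
    larger than its own. *)
Lemma value_close f g : f != 0 -> Pgt mu (mu f) (f - g) -> g != 0 /\ mu g = mu f.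
Proof.
move=> f0 h; have g0 : g != 0.
  by apply: contraTneq h => ->; rewrite subr0 Pgt_nz // glt_gg.
split=> //; apply: value_eq => //.
  rewrite -[g](subKr f); apply: PgeB; [exact: Pge_refl | exact: PgtW].
apply/negP => hg; have := PgtD h hg; by rewrite subrK Pgt_nz // (glt_gg oC).
Qed.

Lemma valuationX f n : f != 0 -> mu (f ^+ n) = mu f *+ n.
Proof.
move=> f0; elim: n => [|n IH]; first by rewrite expr0 valuation1.
by rewrite exprS mulrS valuationM ?expf_neq0 // IH.
Qed.

End Valuation.
End Filtration.

(** * Augmented valuations *)

Section Expansion.
Variables (K : fieldType) (p : {poly K}).
Hypothesis p1 : (1 < size p)%N.
Implicit Types f g a b : {poly K}.

Lemma phi_neq0 : p != 0.
Proof. by rewrite -size_poly_gt0 ltnW. Qed.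

Lemma ltn_size_divp f : f != 0 -> (size (f %/ p)%R < size f)%N.
Proof.
move=> f0; have sf : (0 < size f)%N by rewrite size_poly_gt0.
rewrite size_divp ?phi_neq0 //; move: p1 sf.
by case: (size p) => // -[|n] // _; case: (size f) => // m _; rewrite subSS ltnS leq_subr.
Qed.

Lemma size_phiexp f : size (phiexp p f) = size f.
Proof.
have h k g : size (phiexp_rec k p g) = k by elim: k g => //= k IH g; rewrite IH.
exact: h.
Qed.

(** Each division by [p] lowers the size, so a fuel of [size f] reaches the quotient 0. The digits
    do not depend on the fuel beyond that, which lets [coefsS] compare the expansions of [f] and
    [f %/ p]. *)
Lemma nth_phiexp_rec k f s : (size f <= k)%N ->
  nth 0 (phiexp_rec k p f) s = iter s (fun g => g %/ p) f %% p.
Proof.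
elim: k f s => [|k IH] f s sf /=.
  move: sf; rewrite leqn0 size_poly_eq0 => /eqP ->.
  have -> : iter s (fun g => g %/ p) 0 = 0 by elim: s => //= s ->; rewrite div0p.
  by rewrite nth_nil mod0p.
case: s => [|s] //; rewrite iterSr /= IH //.
case: (eqVneq f 0) => [->|f0]; first by rewrite div0p size_poly0.
by rewrite -ltnS; apply: leq_trans sf; apply: ltn_size_divp.
Qed.

Lemma coefs0 f : coefs p f 0 = f %% p.
Proof. by rewrite /coefs nth_phiexp_rec. Qed.

Lemma coefsS f s : coefs p f s.+1 = coefs p (f %/ p) s.
Proof. by rewrite /coefs !nth_phiexp_rec // iterSr. Qed.

Lemma coefs_ge f s : (size f <= s)%N -> coefs p f s = 0.
Proof. by move=> h; rewrite /coefs nth_default // size_phiexp. Qed.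

Lemma size_coefs f s : (size (coefs p f s) < size p)%N.
Proof. by elim: s f => [|s IH] f; rewrite ?coefs0 ?coefsS // ltn_modp phi_neq0. Qed.

Lemma coefsD f g s : coefs p (f + g) s = coefs p f s + coefs p g s.
Proof. by elim: s f g => [|s IH] f g; rewrite ?coefs0 ?modpD // !coefsS divpD IH. Qed.

Lemma coefs_zero s : coefs p 0 s = 0.
Proof. by rewrite coefs_ge ?size_poly0. Qed.

Lemma coefsN f s : coefs p (- f) s = - coefs p f s.
Proof. by apply/eqP; rewrite -addr_eq0 -coefsD addNr coefs_zero. Qed.

Lemma coefs_mulp0 f : coefs p (f * p) 0 = 0.
Proof. by rewrite coefs0 modp_mull. Qed.

Lemma coefs_mulpS f s : coefs p (f * p) s.+1 = coefs p f s.
Proof. by rewrite coefsS mulpK ?phi_neq0. Qed.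

Lemma coefs_mulX f n : coefs p (f * p ^+ n) n = f %% p.
Proof.
elim: n => [|n IH]; first by rewrite expr0 mulr1 coefs0.
by rewrite exprSr mulrA coefs_mulpS.
Qed.

Lemma coefs_small a s : (size a < size p)%N -> coefs p a s = if s == 0%N then a else 0.
Proof.
case: s => [|s] h; first by rewrite coefs0 modp_small.
by rewrite coefsS divp_small // coefs_zero.
Qed.

Lemma coefs_monomial a n s : (size a < size p)%N ->
  coefs p (a * p ^+ n) s = if s == n then a else 0.
Proof.
elim: n s => [|n IH] s h; first by rewrite expr0 mulr1 coefs_small.
rewrite exprSr mulrA; case: s => [|s]; first by rewrite coefs_mulp0.
by rewrite coefs_mulpS IH.
Qed.

(** The expansion of such a product stops after two digits, which is why [aug_mul] only has to
    control the remainder and the quotient by [p]. *)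
Lemma size_divp_mul_small a b : (size a < size p)%N -> (size b < size p)%N ->
  (size ((a * b) %/ p)%R < size p)%N.
Proof.
move=> ha hb; rewrite size_divp ?phi_neq0 //.
apply: leq_ltn_trans (leq_sub2r _ (size_polyMleq _ _)) _.
move: p1 ha hb; case: (size p) => // n; rewrite !ltnS /= => n0 ha hb.
rewrite leq_subLR; apply: leq_trans (leq_pred _) _.
exact: leq_add.
Qed.

Lemma poly_divmod_ind (P : {poly K} -> Prop) :
  P 0 -> (forall f, f != 0 -> P (f %/ p) -> P f) -> forall f, P f.
Proof.
move=> P0 Pn f; have [n] := ubnP (size f); elim: n f => // n IH f sf.
case: (eqVneq f 0) => [->//|f0]; apply: Pn => //; apply: IH.
by apply: leq_trans (ltn_size_divp f0) _.
Qed.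

End Expansion.

Section Augment.
Variables (K : fieldType) (G : lmodType rat) (C : chain K G).
Hypothesis oC : group_order C.
Variables (nu : {poly K} -> G) (p : {poly K}) (gm : G).
Implicit Types f g a b : {poly K}.

(* The multiplicative information on polynomials of degree < deg p that makes
   [nu; p, gm] a valuation; it holds for key polynomials, and for p = x + a
   when nu is only defined on constants. *)
Record augmentable : Prop := Augmentable {
  aug_size : (1 < size p)%N;
  aug_ultra : forall a b, (size a < size p)%N -> (size b < size p)%N ->
    ultrametric_at C nu a b;
  aug_mul : forall a b, a != 0 -> b != 0 -> (size a < size p)%N -> (size b < size p)%N ->
    [/\ (a * b) %% p != 0, nu ((a * b) %% p) = nu a + nu b &
        Pgt C nu (nu a + nu b - gm) ((a * b) %/ p)]
}.

Hypothesis aug : augmentable.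
Let p1 := aug_size aug.
Local Notation mu := (augment C nu p gm).

Lemma augment_attained f : f != 0 ->
  exists2 s, coefs p f s != 0 & mu f = nu (coefs p f s) + gm *+ s.
Proof.
move=> f0; rewrite /augment; set l := [seq _ | _ <- _ & _].
suff /(gminl_in oC) : l != [::].
  by case/mapP => s; rewrite mem_filter => /andP[h _] ->; exists s.
apply/negP => /eqP l0.
have h s : coefs p f s = 0.
  case: (leqP (size f) s) => hs; first by rewrite coefs_ge.
  apply/eqP; apply/negPn/negP => hc.
  have : (nu (coefs p f s) + gm *+ s) \in l.
    by apply: map_f; rewrite mem_filter hc mem_iota size_phiexp.
  by rewrite l0.
case/negP: f0; apply/eqP; move: h.
elim/(poly_divmod_ind p1): f {l l0} => // f _ IH h.
rewrite [f](divp_eq f p) -(coefs0 p1) h addr0 IH ?mul0r // => s.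
by rewrite -coefsS.
Qed.

Lemma augment_le f s : coefs p f s != 0 -> le C (mu f) (nu (coefs p f s) + gm *+ s).
Proof.
move=> hc; apply: gminl_le => //; apply: map_f; rewrite mem_filter hc mem_iota size_phiexp /=.
by rewrite add0n ltnNge; apply: contra hc => h; rewrite coefs_ge.
Qed.

(** Trades the minimum in [augment] for one condition per digit. Digits are additive, so sums become
    immediate and products yield to induction on division by [p]. *)
Lemma Pge_augment al f :
  Pge C mu al f <-> forall s, Pge C nu (al - gm *+ s) (coefs p f s).
Proof.
split=> [/orP[/eqP-> s|h s]|h].
- by rewrite coefs_zero Pge0.
- case: (eqVneq (coefs p f s) 0) => [->|hc]; first exact: Pge0.
  by rewrite Pge_nz // le_subgl // (le_g_trans oC h) // augment_le.
- case: (eqVneq f 0) => [->|f0]; first exact: Pge0.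
  case: (augment_attained f0) => s hs e; have := h s.
  by rewrite !Pge_nz // e le_subgl.
Qed.

Lemma Pgt_augment al f :
  Pgt C mu al f <-> forall s, Pgt C nu (al - gm *+ s) (coefs p f s).
Proof.
split=> [/orP[/eqP-> s|h s]|h].
- by rewrite coefs_zero Pgt0.
- case: (eqVneq (coefs p f s) 0) => [->|hc]; first exact: Pgt0.
  by rewrite Pgt_nz // glt_subgl // (glt_le_trans oC h) // augment_le.
- case: (eqVneq f 0) => [->|f0]; first exact: Pgt0.
  case: (augment_attained f0) => s hs e; have := h s.
  by rewrite !Pgt_nz // e glt_subgl.
Qed.

Lemma Pge_augment_divmod al f :
  Pge C mu al f <-> Pge C nu al (f %% p) /\ Pge C mu (al - gm) (f %/ p).
Proof.
split=> [/Pge_augment h|[h0 /Pge_augment h]].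
  split; first by have := h 0%N; rewrite coefs0 // mulr0n subr0.
  apply/Pge_augment => s; have := h s.+1.
  by rewrite coefsS // mulrS opprD addrA.
apply/Pge_augment => -[|s]; first by rewrite coefs0 // mulr0n subr0.
by rewrite coefsS // mulrS opprD addrA.
Qed.

Lemma Pgt_augment_divmod al f :
  Pgt C mu al f <-> Pgt C nu al (f %% p) /\ Pgt C mu (al - gm) (f %/ p).
Proof.
split=> [/Pgt_augment h|[h0 /Pgt_augment h]].
  split; first by have := h 0%N; rewrite coefs0 // mulr0n subr0.
  apply/Pgt_augment => s; have := h s.+1.
  by rewrite coefsS // mulrS opprD addrA.
apply/Pgt_augment => -[|s]; first by rewrite coefs0 // mulr0n subr0.
by rewrite coefsS // mulrS opprD addrA.
Qed.

Lemma Pge_augment_small al a : (size a < size p)%N -> Pge C mu al a <-> Pge C nu al a.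
Proof.
move=> sa; rewrite Pge_augment_divmod modp_small // divp_small //.
by split=> [[]//|h]; split=> //; apply: Pge0.
Qed.

Lemma Pgt_augment_small al a : (size a < size p)%N -> Pgt C mu al a <-> Pgt C nu al a.
Proof.
move=> sa; rewrite Pgt_augment_divmod modp_small // divp_small //.
by split=> [[]//|h]; split=> //; apply: Pgt0.
Qed.

Lemma Pge_augment_mulp al f : Pge C mu al (f * p) <-> Pge C mu (al - gm) f.
Proof.
rewrite Pge_augment_divmod modp_mull mulpK ?phi_neq0 //.
by split=> [[]//|h]; split=> //; apply: Pge0.
Qed.

Lemma Pgt_augment_mulp al f : Pgt C mu al (f * p) <-> Pgt C mu (al - gm) f.
Proof.
rewrite Pgt_augment_divmod modp_mull mulpK ?phi_neq0 //.
by split=> [[]//|h]; split=> //; apply: Pgt0.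
Qed.

Lemma augment_small a : a != 0 -> (size a < size p)%N -> mu a = nu a.
Proof.
move=> a0 sa; apply: (value_eq oC) => //.
  by apply/Pge_augment_small => //; apply: Pge_refl.
by apply/negP => /(Pgt_augment_small _ sa); rewrite Pgt_nz // (glt_gg oC).
Qed.

Lemma PgeD_augment al f g : Pge C mu al f -> Pge C mu al g -> Pge C mu al (f + g).
Proof.
move=> /Pge_augment hf /Pge_augment hg; apply/Pge_augment => s.
by rewrite coefsD //; apply: PgeD_at => //; apply: (aug_ultra aug); apply: size_coefs.
Qed.

Lemma augment_ultra f g : ultrametric_at C mu f g.
Proof. by apply: ultrametric_of_Pge => // al; apply: PgeD_augment. Qed.

(** A product of two polynomials of degree below that of [p] has two digits, both bounded by
    [aug_mul]. Division induction extends the bound to the second factor and then to the first, each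
    factor [p] contributing exactly [gm]. *)
Lemma PgeM_augment al be f g :
  Pge C mu al f -> Pge C mu be g -> Pge C mu (al + be) (f * g).
Proof.
have small_small a b al' be' : (size a < size p)%N -> (size b < size p)%N ->
    Pge C nu al' a -> Pge C nu be' b -> Pge C mu (al' + be') (a * b).
  move=> sa sb; case: (eqVneq a 0) => [->|a0]; first by move=> *; rewrite mul0r Pge0.
  case: (eqVneq b 0) => [->|b0]; first by move=> *; rewrite mulr0 Pge0.
  move=> ha hb; rewrite !Pge_nz // in ha hb; have [d0 dv cv] := aug_mul aug a0 b0 sa sb.
  apply/Pge_augment_divmod; split; first by rewrite Pge_nz // dv le_gD.
  apply/Pge_augment_small; first exact: size_divp_mul_small.
  apply: PgtW; apply: Pgt_mono cv => //.
  by rewrite le_gD2r // le_gD.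
have small_any a al' be' h : (size a < size p)%N ->
    Pge C nu al' a -> Pge C mu be' h -> Pge C mu (al' + be') (a * h).
  move=> sa ha; elim/(poly_divmod_ind p1): h be' => [|h _ IH] be'.
    by move=> _; rewrite mulr0 Pge0.
  case/Pge_augment_divmod => h1 h2.
  rewrite [h](divp_eq h p) mulrDr; apply: PgeD_augment; last first.
    by apply: small_small => //; rewrite ltn_modp phi_neq0.
  by rewrite mulrA; apply/Pge_augment_mulp; rewrite -addrA; apply: IH.
move=> hf hg; elim/(poly_divmod_ind p1): f al hf => [|f _ IH] al.
  by move=> _; rewrite mul0r Pge0.
case/Pge_augment_divmod => h1 h2.
rewrite [f](divp_eq f p) mulrDl; apply: PgeD_augment; last first.
  by apply: small_any => //; rewrite ltn_modp phi_neq0.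
by rewrite mulrAC; apply/Pge_augment_mulp; rewrite addrAC; apply: IH.
Qed.

Lemma augment_mulp f : f != 0 -> mu (f * p) = mu f + gm.
Proof.
move=> f0; apply: (value_eq oC); first by rewrite mulf_neq0 // (phi_neq0 p1).
  by apply/Pge_augment_mulp; rewrite addrK Pge_refl.
by apply/negP => /Pgt_augment_mulp; rewrite addrK Pgt_nz // (glt_gg oC).
Qed.

Lemma PgtM_augment al be f g :
  Pgt C mu al f -> Pge C mu be g -> Pgt C mu (al + be) (f * g).
Proof.
case/orP => [/eqP ->|hf hg]; first by rewrite mul0r Pgt0.
apply: (@Pge_Pgt _ _ _ oC _ _ (mu f + be)); first by rewrite glt_D2r.
by apply: PgeM_augment => //; apply: Pge_refl.
Qed.

Lemma PgtD_augment al f g : Pgt C mu al f -> Pgt C mu al g -> Pgt C mu al (f + g).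
Proof. by apply: PgtD_at => //; apply: augment_ultra. Qed.

(** Multiplicativity of the augmentation is not yet available, so signs are handled digit by digit:
    [aug_mul] applied to -1 gives twice [nu (-1)] equal to [nu 1 = 0], and the values have no
    torsion. *)
Lemma augmentN f : mu (- f) = mu f.
Proof.
have s1 : (size (1%R : {poly K}) < size p)%N by rewrite size_poly1.
have sN1 : (size (- 1 : {poly K})%R < size p)%N by rewrite size_polyN.
have n1 : (-1 : {poly K}) != 0 by rewrite oppr_eq0 oner_neq0.
have nu1 : nu 1 = 0.
  have [_ + _] := aug_mul aug (oner_neq0 _) (oner_neq0 _) s1 s1.
  by rewrite mulr1 modp_small // => /eqP; rewrite -subr_eq subrr eq_sym => /eqP.
have nuN1 : nu (-1) = 0.
  have [_ + _] := aug_mul aug n1 n1 sN1 sN1.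
  by rewrite mulrNN mulr1 modp_small // nu1 -mulr2n => /esym /mulrn_rat_eq0; apply.
have nuN a : a != 0 -> (size a < size p)%N -> nu (- a) = nu a.
  move=> a0 sa; have [_ + _] := aug_mul aug n1 a0 sN1 sa.
  by rewrite mulN1r modp_small ?size_polyN // nuN1 add0r.
rewrite /augment /phiexp !size_phiexp size_polyN; congr gminl.
have ec s : (coefs p (- f) s != 0) = (coefs p f s != 0) by rewrite coefsN // oppr_eq0.
rewrite (eq_filter ec); apply/eq_in_map => s; rewrite mem_filter => /andP[hs _].
by rewrite coefsN // nuN // size_coefs.
Qed.

Lemma PgeN_augment al f : Pge C mu al (- f) = Pge C mu al f.
Proof. by rewrite /Pge oppr_eq0 augmentN. Qed.

Lemma PgtN_augment al f : Pgt C mu al (- f) = Pgt C mu al f.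
Proof. by rewrite /Pgt oppr_eq0 augmentN. Qed.

(* a p^s is the first term of the expansion of f that has minimal value *)
Lemma augment_initial_term f : f != 0 ->
  exists s a l h, [/\ f = l + a * p ^+ s + h * p ^+ s.+1, a != 0, (size a < size p)%N,
    Pgt C mu (mu f) l & nu a + gm *+ s = mu f].
Proof.
elim/(poly_divmod_ind p1): f => [|f f0 IH _]; first by rewrite eqxx.
have/Pge_augment_divmod [h1 h2] := Pge_refl oC mu f.
have sm : (size (f %% p)%R < size p)%N by rewrite ltn_modp phi_neq0.
case: (boolP (Pgt C nu (mu f) (f %% p))) => hm; last first.
  have a0 : f %% p != 0 by apply: contraNneq hm => ->; apply: Pgt0.
  exists 0%N, (f %% p), 0, (f %/ p); split=> //; first by rewrite add0r expr0 mulr1 addrC -divp_eq.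
    exact: Pgt0.
  by rewrite mulr0n addr0; apply: (value_eq oC).
(* The remainder does not attain [mu f], so the quotient attains [mu f - gm]; its first minimal term
   moves up by one power of [p]. *)
have nq : ~~ Pgt C mu (mu f - gm) (f %/ p).
  apply/negP => hq; have/(Pgt_augment_divmod _ _) : Pgt C nu (mu f) (f %% p) /\
    Pgt C mu (mu f - gm) (f %/ p) by [].
  by rewrite Pgt_nz // (glt_gg oC).
have q0 : f %/ p != 0 by apply: contraNneq nq => ->; apply: Pgt0.
have vq : mu (f %/ p) = mu f - gm by apply: (value_eq oC).
have [s [a [l [h [e a0 sa hl va]]]]] := IH q0.
exists s.+1, a, (f %% p + l * p), h; split=> //.
- by rewrite [LHS](divp_eq f p) {1}e !mulrDl -!mulrA -!exprSr; ring.
- apply: PgtD_augment; first exact/Pgt_augment_small.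
  by apply/Pgt_augment_mulp; rewrite -vq.
- by rewrite mulrS addrCA va vq addrC subrK.
Qed.

(** The argument of Gauss's lemma: the first minimal terms [a * p ^+ s] and [b * p ^+ t] produce a
    digit of [f * g], up to higher value, that nothing cancels, so the value of the product cannot
    exceed the sum. *)
Lemma augment_valuation : valuation C mu.
Proof.
split; last exact: augment_ultra.
move=> f g f0 g0; apply: (value_eq oC); first exact: mulf_neq0.
  by apply: PgeM_augment; apply: Pge_refl.
apply/negP => hfg.
have [s [a [l [h [ef a0 sa hl va]]]]] := augment_initial_term f0.
have [t [b [l' [h' [eg b0 sb hl' vb]]]]] := augment_initial_term g0.
have hfl : Pge C mu (mu f) (f - l).
  by apply: PgeD_augment; rewrite ?PgeN_augment ?Pge_refl // PgtW.
have : Pgt C mu (mu f + mu g) (f * g + (- (l * g)) + - ((f - l) * l')).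
  apply: PgtD_augment; first apply: PgtD_augment => //; rewrite PgtN_augment.
    by apply: PgtM_augment => //; apply: Pge_refl.
  by rewrite addrC mulrC; apply: PgtM_augment.
(* The left side is [(f - l) * (g - l')]. It is divisible by [p ^+ (s + t)], so its digit there
   receives no carry and equals the remainder of [a * b]. *)
have -> : f * g + (- (l * g)) + - ((f - l) * l') =
   (a * b + (a * h' + h * b + h * h' * p) * p) * p ^+ (s + t).
  by rewrite {1 2}eg {1 2}ef exprD !exprS; ring.
move/Pgt_augment/(_ (s + t)%N); rewrite coefs_mulX // modpD modp_mull addr0.
have [d0 dv _] := aug_mul aug a0 b0 sa sb.
by rewrite Pgt_nz // dv -va -vb mulrnDr addrACA addrK (glt_gg oC).
Qed.

End Augment.

(** * Key polynomials *)

Local Notation gcomp := Defs.comp.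

Section Graded.
Variables (K : fieldType) (G : lmodType rat) (C : chain K G).
Implicit Types (a b : gr K G) (f g h c : {poly K}) (al be : G).

Lemma comp_single al f be : gcomp [:: (al, f)] be = if be == al then f else 0.
Proof. by rewrite /gcomp big_cons big_nil /= eq_sym addr0; case: ifP. Qed.

Lemma comp_cat a b be : gcomp (a ++ b) be = gcomp a be + gcomp b be.
Proof. by rewrite /gcomp big_cat. Qed.

Lemma comp_gmul a b be : gcomp (gmul a b) be = \sum_(x <- a) x.2 * gcomp b (be - x.1).
Proof.
rewrite /Defs.comp /gmul big_mkcond big_allpairs_dep /=; apply: eq_bigr => x _.
rewrite -big_mkcond mulr_sumr /=; apply: eq_bigl => y.
by rewrite [RHS]eq_sym subr_eq eq_sym addrC.
Qed.

Lemma greqP mu a b : greq C mu a b <-> forall be, Pgt C mu be (gcomp a be - gcomp b be).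
Proof.
split=> h be; first by case: (h be) => [->|h']; rewrite /Pgt ?eqxx ?h' ?orbT.
by case/orP: (h be) => [/eqP|]; [left | right].
Qed.

End Graded.

Section KeyPoly.
Variables (K : fieldType) (G : lmodType rat) (C : chain K G).
Hypothesis oC : group_order C.
Variable mu : {poly K} -> G.
Hypothesis muV : valuation C mu.
Implicit Types f g h c a b : {poly K}.

(** Both initial forms are homogeneous, so only the component of degree [mu g - mu h] of a cofactor
    matters. *)
Lemma mu_divP h g : h != 0 -> g != 0 ->
  mu_div C mu h g <-> exists c, Pgt C mu (mu g) (g - h * c).
Proof.
move=> h0 g0; rewrite /mu_div /gdvd /Hmu (negbTE h0) (negbTE g0); split.
  case=> c [_ /greqP/(_ (mu g))]; rewrite comp_gmul big_cons big_nil /= addr0 comp_single eqxx.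
  by exists (gcomp c (mu g - mu h)); rewrite (Pgt_subC muV).
case=> c hc; exists [:: (mu g - mu h, c)].
have [hc0 vhc] := value_close oC muV g0 hc.
have c0 : c != 0 by apply: contraNneq hc0 => ->; rewrite mulr0.
split.
  rewrite /valid /= (negbTE c0) andbT /= le_subgl // addrC -(valuationM muV) //.
  by rewrite vhc le_gg.
apply/greqP => be; rewrite comp_gmul big_cons big_nil /= addr0 !comp_single.
rewrite (inj_eq (addIr _)); case: eqP => [->|_]; first by rewrite (Pgt_subC muV).
by rewrite mulr0 subrr Pgt0.
Qed.

Section Fixed.
Variables (p : {poly K}) (gm : G).
Hypothesis pkey : key_poly C mu p.
Hypothesis gm_gt : glt C (mu p) gm.

Lemma key_neq0 : p != 0.
Proof. by case: pkey => /monic_neq0. Qed.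

(** A constant monic polynomial is 1, whose initial form is a unit and hence not prime. *)
Lemma key_size : (1 < size p)%N.
Proof.
case: pkey => pm [[_ [nu1 _]] _]; rewrite ltnNge; apply/negP => sp; apply: nu1.
have -> : p = 1.
  by move: pm; rewrite (size1_polyC sp) monicE lead_coefC => /eqP ->.
exists (gone K G); split.
  by rewrite /valid /= (valuation1 muV) (le_gg oC) orbT.
rewrite /Hmu oner_eq0 (valuation1 muV); apply/greqP => be.
by rewrite comp_gmul big_cons big_nil /= mul1r addr0 subr0 subrr Pgt0.
Qed.

Lemma key_minimal f c : f != 0 -> (size f < size p)%N -> ~~ Pgt C mu (mu f) (f - p * c).
Proof.
move=> f0 sf; apply/negP => h; case: pkey => _ [_ /(_ f f0 sf)]; apply.
by apply/mu_divP => //; [apply: key_neq0 | exists c].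
Qed.

(** Primality would pass the divisibility from the product to [a] or [b], and minimality forbids
    both. *)
Lemma key_prime a b c : a != 0 -> b != 0 -> (size a < size p)%N -> (size b < size p)%N ->
  ~~ Pgt C mu (mu (a * b)) (a * b - p * c).
Proof.
move=> a0 b0 sa sb; apply/negP => h; case: pkey => _ [[_ [_ pr]] pmin].
have vH f : valid C mu (Hmu mu f).
  by rewrite /Hmu; case: eqP => // _; rewrite /valid /= (le_gg oC) orbT.
case: (pr _ _ (vH a) (vH b)); [|exact: pmin|exact: pmin].
have -> : gmul (Hmu mu a) (Hmu mu b) = Hmu mu (a * b).
  by rewrite /Hmu (negbTE a0) (negbTE b0) (negbTE (mulf_neq0 a0 b0)) (valuationM muV).
by apply/mu_divP; [apply: key_neq0 | apply: mulf_neq0 | exists c].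
Qed.

(** If the remainder had value below that of [f], it would agree up to higher value with a multiple
    of [p], so [p] would mu-divide a polynomial of smaller degree. *)
Lemma key_Pge_mod al f : Pge C mu al f -> Pge C mu al (f %% p).
Proof.
move=> hf; case: (eqVneq (f %% p) 0) => [->|a0]; first exact: Pge0.
rewrite Pge_nz // (gle_ngt oC); apply/negP => hlt.
have/negP := key_minimal (- (f %/ p)) a0 (etrans (ltn_modp _ _) key_neq0); apply.
have -> : f %% p - p * - (f %/ p) = f by rewrite [in RHS](divp_eq f p); ring.
exact: (Pge_Pgt oC) hlt hf.
Qed.

Lemma key_Pge_div al f : Pge C mu al f -> Pge C mu (al - mu p) (f %/ p).
Proof.
move=> hf; have := PgeB oC muV hf (key_Pge_mod hf).
rewrite {1}[f](divp_eq f p) addrK => h.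
by rewrite -(Pge_mulE oC muV _ _ key_neq0) addrC subrK mulrC.
Qed.

Lemma key_augmentable : augmentable C mu p gm.
Proof.
split; first exact: key_size.
  by move=> a b _ _; case: muV.
move=> a b a0 b0 sa sb; have ab0 := mulf_neq0 a0 b0.
have nP c : ~~ Pgt C mu (mu (a * b)) (a * b - p * c) by apply: key_prime.
have nM : ~~ Pgt C mu (mu (a * b)) ((a * b) %% p).
  have -> : (a * b) %% p = a * b - p * ((a * b) %/ p).
    by rewrite {2}(divp_eq (a * b) p) [p * _]mulrC addrAC subrr add0r.
  exact: nP.
have m0 : (a * b) %% p != 0 by apply: contraNneq nM => ->; apply: Pgt0.
rewrite -(valuationM muV) //; split=> //.
  by apply: (value_eq oC) => //; apply: key_Pge_mod; apply: Pge_refl.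
(* In passing to the quotient only [mu p] is lost, and [mu p < gm] gives the strict bound. *)
apply: (Pge_Pgt oC) (key_Pge_div (Pge_refl oC mu (a * b))).
by rewrite glt_D2l // glt_N2.
Qed.

Local Notation mu' := (augment C mu p gm).
Let mu'V : valuation C mu' := augment_valuation oC key_augmentable.

(** This is the inequality between the two valuations: the remainder keeps the bound, and the
    quotient loses [mu p], less than the [gm] that its factor [p] restores. Congruences for [mu]
    thus persist for the augmentation. *)
Lemma augment_Pge al f : Pge C mu al f -> Pge C mu' al f.
Proof.
elim/(poly_divmod_ind key_size): f al => [|f _ IH] al hf; first exact: Pge0.
apply/(Pge_augment_divmod oC key_augmentable); split; first exact: key_Pge_mod.
apply: (Pge_mono oC) (IH _ (key_Pge_div hf)).
by rewrite le_gD2l // le_gN2 // gltW.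
Qed.

Lemma augment_Pgt al f : Pgt C mu al f -> Pgt C mu' al f.
Proof.
case/orP => [/eqP ->|h]; first exact: Pgt0.
by apply: (Pge_Pgt oC) h _; apply: augment_Pge; apply: Pge_refl.
Qed.

End Fixed.

(** Invertibility of the initial form, with an inverse that is itself the initial form of a
    polynomial [g]; this [g] later stands for the inverse of a fraction. *)
Definition munit f := f != 0 /\ exists2 g, g != 0 & Pgt C mu 0 (f * g - 1).

Lemma munit_inv_val f g : f != 0 -> g != 0 -> Pgt C mu 0 (f * g - 1) -> mu g = - mu f.
Proof.
move=> f0 g0; rewrite (Pgt_subC muV) -(valuation1 muV) => /(value_close oC muV (oner_neq0 _)) [_].
by rewrite (valuationM muV) // (valuation1 muV) => /eqP; rewrite addrC addr_eq0 => /eqP.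
Qed.

End KeyPoly.

(** * Units of the graded algebra of an augmentation *)

Section Units.
Variables (K : fieldType) (G : lmodType rat) (C : chain K G).
Hypothesis oC : group_order C.
Variable mu : {poly K} -> G.
Hypothesis muV : valuation C mu.
Implicit Types f g h c a b : {poly K}.

Variables (p : {poly K}) (gm : G).
Hypothesis pkey : key_poly C mu p.
Hypothesis gm_gt : glt C (mu p) gm.
Let aug := key_augmentable oC muV pkey gm_gt.
Local Notation mu' := (augment C mu p gm).
Let mu'V : valuation C mu' := augment_valuation oC aug.

(** The values of [f] and of its inverse can only grow, while their sum is 0 for both valuations;
    hence neither changes. *)
Lemma munit_augment f : munit C mu f -> munit C mu' f /\ mu' f = mu f.
Proof.
case=> f0 [g g0 h]; have h' := augment_Pgt oC muV pkey gm_gt h.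
split; first by split=> //; exists g.
have e2 := munit_inv_val oC muV f0 g0 h; have e1 := munit_inv_val oC mu'V f0 g0 h'.
have hf := augment_Pge oC muV pkey gm_gt (Pge_refl oC mu f).
have hg := augment_Pge oC muV pkey gm_gt (Pge_refl oC mu g).
rewrite !Pge_nz // in hf hg; apply: (le_g_anti oC) => //.
by rewrite -(le_gN2 oC) -e1 -e2.
Qed.

(** A proper factorization of [p] would give two factors of smaller degree whose product has
    remainder 0, against [aug_mul]. So [p] is irreducible and prime to [a]. *)
Lemma bezout_small a : a != 0 -> (size a < size p)%N ->
  exists b, [/\ b != 0, (size b < size p)%N & (a * b) %% p = 1].
Proof.
have p0 := phi_neq0 (aug_size aug).
move=> a0 sa; have /Bezout_coprimepP [[u v] /= ] : coprimep a p.
  apply/coprimepP => d da dp.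
  have d0 : d != 0 by apply: contraTneq da => ->; rewrite dvd0p.
  rewrite -size_poly_eq1; apply: contraT => sd1.
  have sd : (size d < size p)%N by apply: leq_ltn_trans (dvdp_leq a0 da) sa.
  have ek := divpK dp; have k0 : p %/ d != 0.
    by apply: contraNneq p0 => k0; rewrite -ek k0 mul0r.
  have sk : (size (p %/ d)%R < size p)%N.
    apply: ltn_size_divp => //; rewrite ltnNge; apply: contra sd1 => h.
    by rewrite eqn_leq h size_poly_gt0.
  have [+ _ _] := aug_mul aug k0 d0 sk sd.
  by rewrite ek modpp eqxx.
rewrite eqp_sym => /eqpP [[c1 c2]] /= /andP[c10 c20] e.
(* The Bezout combination is only associated to 1; the factor [c2 / c1] makes it equal to 1. *)
pose b := ((c2 / c1) *: u) %% p.
have hb : (a * b) %% p = 1.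
  rewrite /b modp_mul -scalerAr; apply: esym.
  have -> : (c2 / c1) *: (a * u) = (- (c2 / c1)) *: v * p + 1.
    rewrite -[1](scalerK c10) e scalerA scalerDr scaleNr mulNr -scalerAl [c1^-1 * _]mulrC.
    by rewrite [u * a]mulrC addrCA addNr addr0.
  by rewrite modpD modp_mull add0r modp_small // size_poly1 (aug_size aug).
exists b; split=> //; last by rewrite ltn_modp.
apply: contraTneq (oner_neq0 {poly K}) => e0; rewrite -hb e0 mulr0 mod0p.
by rewrite eqxx.
Qed.

(** The remainder [a] of [f] has the same value as [f] and is inverted modulo [p] by some [b]. Then
    [f * b - 1] is a sum of two multiples of [p], and both have positive value once [p] is worth
    [gm]. *)
Lemma munit_not_mu_div f : f != 0 -> ~ mu_div C mu p f ->
  munit C mu' f /\ mu' f = mu f.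
Proof.
have p0 := phi_neq0 (aug_size aug).
move=> f0 hf; set a := f %% p.
have nP c : ~~ Pgt C mu (mu f) (f - p * c).
  by apply/negP => h; apply: hf; apply/(mu_divP oC muV) => //; exists c.
have ea : a = f - p * (f %/ p) by rewrite {1}(divp_eq f p) [p * _]mulrC addrAC subrr add0r.
have a0 : a != 0 by apply: contraNneq (nP (f %/ p)) => e; rewrite -ea e Pgt0.
have sa : (size a < size p)%N by rewrite ltn_modp.
have va : mu a = mu f.
  apply: (value_eq oC) => //; last by rewrite ea.
  by apply: (key_Pge_mod oC muV pkey); apply: Pge_refl.
have vf : mu' f = mu f.
  apply: (value_eq oC) => //; first by apply: augment_Pge => //; apply: Pge_refl.
  apply/negP => /(Pgt_augment_divmod oC aug)[+ _].
  by rewrite -/a Pgt_nz // va (glt_gg oC).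
have [b [b0 sb hb]] := bezout_small a0 sa.
have [_ vab cab] := aug_mul aug a0 b0 sa sb.
rewrite hb (valuation1 muV) in vab; rewrite -vab sub0r in cab.
split=> //; split=> //; exists b => //.
have -> : f * b - 1 = (f %/ p) * p * b + (a * b) %/ p * p.
  rewrite {1}(divp_eq f p) -/a mulrDl; have := divp_eq (a * b) p; rewrite hb => {1}->.
  by ring.
apply: (PgtD oC mu'V).
  have -> : 0 = mu a + mu b by rewrite -vab.
  rewrite -(augment_small oC aug b0 sb).
  apply: (PgtMl oC mu'V); last exact: Pge_refl.
  apply/(Pgt_augment_mulp oC aug).
  apply: (@Pge_Pgt _ _ _ oC _ _ (mu a - mu p)).
    by rewrite glt_D2l // glt_N2.
  apply: (augment_Pge oC muV pkey gm_gt); rewrite va.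
  by apply: (key_Pge_div oC muV pkey); apply: Pge_refl.
apply/(Pgt_augment_mulp oC aug); rewrite sub0r.
by apply/(Pgt_augment_small oC aug) => //; apply: (size_divp_mul_small (aug_size aug)).
Qed.

End Units.

(** * The valuations of a MacLane chain *)

(* If gm has order d modulo A, its multiples meet at most d classes, so that e <= d. *)
Lemma index_dvd_generator (G : lmodType rat) (A B : G -> Prop) (gm : G) (e : nat) (n : int) :
  A 0 -> (forall x y, A x -> A y -> A (x - y)) ->
  (forall x, B x -> exists m : int, A (x - gm *~ m)) ->
  index_is A B e -> (0 < e)%N -> A (gm *+ e) -> A (gm *~ n) -> (e%:Z %| n)%Z.
Proof.
move=> A0 AB BA [b [bB [binj _]]] e0 Ae An.
have AN x : A x -> A (- x) by move=> hx; rewrite -sub0r; apply: AB.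
have AD x y : A x -> A y -> A (x + y).
  by move=> hx hy; rewrite -[y]opprK; apply: AB => //; apply: AN.
have Amz x (m : int) : A x -> A (x *~ m).
  move=> hx; have Amn k : A (x *+ k).
    by elim: k => [|k IH]; rewrite ?mulr0n // mulrS; apply: AD.
  case: m => k; first by rewrite -pmulrn.
  by rewrite NegzE mulrNz -pmulrn; apply: AN.
(* [d] may be a proper multiple of the order of [gm] modulo [A]; what counts is that [gm *~ d] lies
   in [A] and that [d] divides both [e] and [n]. *)
set d := gcdz e%:Z n.
have Ad : A (gm *~ d).
  rewrite /d; have [u [v <-]] := Bezoutz e%:Z n.
  by rewrite mulrzDr [u * _]mulrC [v * _]mulrC !mulrzA; apply: AD; apply: Amz.
have d0 : d != 0 by rewrite /d gcdz_eq0; case: (e) e0.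
have dge0 : 0 <= d by rewrite /d /gcdz.
have hex (k : 'I_e) : exists m : int, A (b k - gm *~ m) by apply/BA/bB.
have [c hc] := fin_all_exists hex.
have dpos : (0 < `|d|)%N by rewrite absz_gt0.
pose h (k : 'I_e) : 'I_(`|d|) := Ordinal (ltn_pmod `|(c k %% d)%Z| dpos).
have hinj : injective h.
  move=> k l /(congr1 val) /=; have lt m : (`|(m %% d)%Z| < `|d|)%N.
    by rewrite -ltz_nat gez0_abs ?modz_ge0 // abszE ltz_mod.
  rewrite !modn_small // => /(congr1 Posz); rewrite !gez0_abs ?modz_ge0 // => ecl.
  apply/val_inj/(binj _ _ (ltn_ord k) (ltn_ord l)).
  have := AB _ _ (hc k) (hc l).
  have -> : b k - gm *~ c k - (b l - gm *~ c l) = b k - b l - gm *~ (c k - c l).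
    by rewrite mulrzBr !opprB addrACA [RHS]addrACA [- b l - _]addrC.
  move/eqP: ecl; rewrite eqz_mod_dvd => /dvdzP[q ->] hA.
  by have := AD _ _ hA (Amz _ q Ad); rewrite -mulrzA [d * q]mulrC subrK.
have := leq_card _ hinj; rewrite !card_ord => led.
have de : `|d|%N = e.
  apply/eqP; rewrite eqn_leq led andbT; apply: dvdn_leq => //.
  exact: (dvdz_gcdl e%:Z n).
have -> : e%:Z = d by rewrite -de gez0_abs.
exact: dvdz_gcdr.
Qed.

Section Chain.
Variables (K : fieldType) (G : lmodType rat) (C : chain K G) (r : nat).
Hypothesis setup : MacLane_setup C r.
Implicit Types (f g a b : {poly K}) (x y : G).

Lemma setup_order : group_order C. Proof. by case: setup. Qed.
Let oC := setup_order.

Lemma valuation_K : (forall a b : K, a != 0 -> b != 0 -> Defs.val C (a * b) = Defs.val C a + Defs.val C b) /\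
  (forall a b : K, a != 0 -> b != 0 -> a + b != 0 ->
     le C (gmin C (Defs.val C a) (Defs.val C b)) (Defs.val C (a + b))).
Proof. by case: setup => _ []. Qed.

Lemma phi0_eq : exists a : K, phi C 0 = 'X + a%:P.
Proof. by case: setup => _ _ []. Qed.

Lemma phi_key i : (0 < i <= r)%N ->
  key_poly C (muc C i) (phi C i) /\ glt C (muc C i (phi C i)) (gam C i).
Proof. by case: setup => _ _ [_ h _ _] _ _; apply: h. Qed.

(** Polynomials smaller than [phi 0] are constants. There [muc 0] is v, and a product of two of them
    is its own remainder, with quotient 0. *)
Lemma augmentable0 : augmentable C (muc C 0) (phi C 0) (gam C 0).
Proof.
have [c ->] := phi0_eq; have [vM vD] := valuation_K.
have sp : size ('X + c%:P) = 2 by rewrite size_XaddC.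
have small f : (size f < 2)%N -> exists k, f = k%:P.
  by move=> h; exists f`_0; apply: size1_polyC.
split; rewrite ?sp //.
  move=> a b /small[x ->] /small[y ->].
  by rewrite /ultrametric_at -polyCD /= !coefC /= !polyC_eq0; apply: vD.
move=> a b a0 b0 /small[x ex] /small[y ey]; move: a0 b0.
rewrite ex ey !polyC_eq0 -polyCM => x0 y0.
have s1 : (size (x * y)%:P < size ('X + c%:P)%R)%N.
  by rewrite sp ltnS size_polyC_leq1.
by rewrite modp_small // divp_small // polyC_eq0 mulf_neq0 //= !coefC /= vM // Pgt0.
Qed.

Lemma muc_augmentable i : (i <= r)%N -> augmentable C (muc C i) (phi C i) (gam C i).
Proof.
elim: i => [_|i IH ir]; first exact: augmentable0.
have [ik ig] := phi_key (i := i.+1) ir.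
apply: key_augmentable => //; apply: augment_valuation => //.
exact: IH (ltnW ir).
Qed.

Lemma muc_valuation i : (i <= r)%N -> valuation C (muc C i.+1).
Proof. by move=> ir; apply: augment_valuation => //; apply: muc_augmentable. Qed.

Lemma muc_const i (c : K) : (i <= r)%N -> c != 0 -> muc C i.+1 c%:P = Defs.val C c.
Proof.
move=> + c0; elim: i => [|i IH] ir.
  rewrite [LHS](augment_small oC (muc_augmentable ir)) /= ?coefC ?polyC_eq0 //.
  by apply: leq_ltn_trans (size_polyC_leq1 _) (aug_size (muc_augmentable ir)).
rewrite [LHS](augment_small oC (muc_augmentable ir)) ?polyC_eq0 //.
  exact: IH (ltnW ir).
by apply: leq_ltn_trans (size_polyC_leq1 _) (aug_size (muc_augmentable ir)).
Qed.

Lemma phi_chain_neq0 i : (i <= r)%N -> phi C i != 0.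
Proof. by move=> /muc_augmentable /aug_size /phi_neq0. Qed.

Lemma muc_phi i : (i <= r)%N -> muc C i.+1 (phi C i) = gam C i.
Proof.
move=> ir; rewrite -[phi C i]mul1r [LHS](augment_mulp oC (muc_augmentable ir)) ?oner_neq0 //.
by rewrite [X in X + _](valuation1 (muc_valuation ir)) add0r.
Qed.

Lemma muc_small i a : (i <= r)%N -> a != 0 -> (size a < size (phi C i))%N ->
  muc C i.+1 a = muc C i a.
Proof. by move=> ir a0 sa; apply: (augment_small oC (muc_augmentable ir)). Qed.

(** At stage i + 1 this is the chain condition that [phi i.+1] does not divide [phi i] for
    [muc i.+1]; every later augmentation keeps the unit and its value. *)
Lemma munit_phi i k : (i < k <= r)%N ->
  munit C (muc C k.+1) (phi C i) /\ muc C k.+1 (phi C i) = gam C i.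
Proof.
case/andP; elim: k => // k IH; rewrite ltnS leq_eqVlt => /orP[/eqP <-|ik] kr.
  have [ck cg] := phi_key (i := i.+1) kr.
  have [u e] := munit_not_mu_div oC (muc_valuation (ltnW kr)) ck cg (phi_chain_neq0 (ltnW kr))
    (let: And5 _ _ (And4 _ _ h _) _ _ := setup in h i kr).
  by split=> //; rewrite [LHS]e muc_phi // ltnW.
have [u e] := IH ik (ltnW kr); have [ck cg] := phi_key (i := k.+1) kr.
have [u' e'] := munit_augment oC (muc_valuation (ltnW kr)) ck cg u.
by split=> //; rewrite -e.
Qed.

Lemma munit_const k (c : K) : c != 0 -> munit C (muc C k) c%:P.
Proof.
move=> c0; split; first by rewrite polyC_eq0.
exists (c^-1)%:P; first by rewrite polyC_eq0 invr_eq0.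
by rewrite -polyCM mulfV // subrr Pgt0.
Qed.

Lemma GamB x y : Gam C x -> Gam C y -> Gam C (x - y).
Proof.
case=> a [a0 <-] [b [b0 <-]]; exists (a / b); split; first by rewrite mulf_neq0 ?invr_eq0.
by rewrite -[a in RHS](mulfVK b0) [in RHS](proj1 valuation_K) ?mulf_neq0 ?invr_eq0 // addrK.
Qed.

Lemma Gam0 : Gam C 0.
Proof.
by rewrite -(subrr (Defs.val C 1)); apply: GamB; exists 1; rewrite oner_neq0.
Qed.

Lemma GamMuB k x y : (k <= r)%N -> GamMu C k x -> GamMu C k y -> GamMu C k (x - y).
Proof.
case: k => [_|k kr]; first exact: GamB.
case=> a [b [a0 [b0 ->]]] [c [d [c0 [d0 ->]]]].
exists (a * d), (b * c); rewrite !mulf_neq0 //; do 2!split => //.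
by rewrite !(valuationM (muc_valuation (ltnW kr))) // opprB opprD addrACA.
Qed.

Lemma GamMu0 k : (k <= r)%N -> GamMu C k 0.
Proof.
case: k => [_|k kr]; first exact: Gam0.
by exists 1, 1; rewrite oner_neq0 subrr.
Qed.

Lemma GamMuN k x : (k <= r)%N -> GamMu C k x -> GamMu C k (- x).
Proof. by move=> kr hx; rewrite -sub0r; apply: GamMuB => //; apply: GamMu0. Qed.

Lemma GamMuD k x y : (k <= r)%N -> GamMu C k x -> GamMu C k y -> GamMu C k (x + y).
Proof. by move=> kr hx hy; rewrite -[y]opprK; apply: GamMuB => //; apply: GamMuN. Qed.

Lemma GamMu_mulrz k x (n : int) : (k <= r)%N -> GamMu C k x -> GamMu C k (x *~ n).
Proof.
move=> kr hx; have hn m : GamMu C k (x *+ m).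
  by elim: m => [|m IH]; rewrite ?mulr0n ?mulrS; [apply: GamMu0 | apply: GamMuD].
case: n => m; first by rewrite -pmulrn.
by rewrite NegzE mulrNz -pmulrn; apply: GamMuN.
Qed.

Lemma GamMu_small k a : (k <= r)%N -> a != 0 -> (size a < size (phi C k))%N ->
  GamMu C k (muc C k a).
Proof.
case: k => [|k] kr a0 sa.
  have [c e] := phi0_eq; move: sa a0; rewrite e size_XaddC => /size1_polyC ->.
  by rewrite polyC_eq0 => h; exists (a`_0); rewrite /= coefC.
exists a, 1; rewrite oner_neq0 (valuation1 (muc_valuation (ltnW kr))) subr0.
by [].
Qed.

Lemma GamMu_Gam k x : (k <= r)%N -> Gam C x -> GamMu C k x.
Proof.
case: k => [//|k] kr [a [a0 <-]]; exists a%:P, 1.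
by rewrite oner_neq0 polyC_eq0 (valuation1 (muc_valuation (ltnW kr))) subr0 muc_const // ltnW.
Qed.

Lemma GamMu_gam t k : (t < k <= r)%N -> GamMu C k (gam C t).
Proof.
case: k => // k /andP[tk kr]; exists (phi C t), 1.
rewrite oner_neq0 (valuation1 (muc_valuation (ltnW kr))) subr0.
rewrite phi_chain_neq0 ?(leq_trans (tk : (t <= k)%N) (ltnW kr)) //; do 2!split => //.
move: tk; rewrite ltnS leq_eqVlt => /orP[/eqP ->|tk]; first by rewrite muc_phi // ltnW.
by case: (@munit_phi t k) => //; rewrite tk ltnW.
Qed.

(** For t < k the element gamma_t is the value of [phi t] under the valuation [muc k], and elements
    of Gamma are values of constants. *)
Lemma GamIdx_GamMu k x : (k <= r)%N -> GamIdx C k x -> GamMu C k x.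
Proof.
move=> kr [c [z ->]].
have hsum n (F : nat -> G) : (forall j, (j < n)%N -> GamMu C k (F j)) ->
    GamMu C k (\sum_(j < n) F j).
  move=> h; apply: (big_ind (GamMu C k)) => [|? ?|j _]; [exact: GamMu0|exact: GamMuD|exact: h].
apply: GamMuD => //.
  apply: (hsum _ (fun j => iota0 C j *~ c j)) => j jr; apply: GamMu_mulrz => //.
  by apply: GamMu_Gam => //; case: setup => _ _ _ [h _ _] _; apply: h.
apply: (hsum _ (fun j => gam C j *~ z j)) => j jr; apply: GamMu_mulrz => //.
by apply: GamMu_gam; rewrite jr.
Qed.

(** [eidx] is given as an index and is used as the order of gamma_i. Each value of [muc i.+1] is
    attained by one term of an expansion, so Gamma_{mu_i} is generated by Gamma_{mu_{i-1}} and
    gamma_i. *)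
Lemma eidx_dvd i (n : int) : (i <= r)%N -> GamMu C i (gam C i *~ n) -> (eidx C i %| n)%Z.
Proof.
move=> ir; case: setup => _ _ [_ _ _ /(_ i ir) [e0 hidx]] [_ _ /(_ i ir) hh] _.
apply: (@index_dvd_generator G (GamMu C i) _ _ _ _ _ _ _ hidx) => //.
- exact: GamMu0.
- by move=> x y; apply: GamMuB.
- have aug := muc_augmentable ir; have p1 := aug_size aug.
  move=> x [a [b [a0 [b0 ->]]]].
  have [s hs es] := augment_attained oC aug a0; have [t ht et] := augment_attained oC aug b0.
  exists (s%:Z - t%:Z); rewrite /= es et mulrzBr -!pmulrn.
  have -> : muc C i (coefs (phi C i) a s) + gam C i *+ s -
    (muc C i (coefs (phi C i) b t) + gam C i *+ t) - (gam C i *+ s - gam C i *+ t) =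
    muc C i (coefs (phi C i) a s) - muc C i (coefs (phi C i) b t).
    by rewrite [- (muc _ _ _ + _)]opprD addrACA addrK.
  by apply: GamMuB => //; apply: GamMu_small => //; apply: size_coefs.
- exact: GamIdx_GamMu hh.
Qed.

End Chain.

(** * The bases of the groups [GamIdx] *)

Section Bases.
Variables (K : fieldType) (G : lmodType rat) (C : chain K G) (r : nat).
Hypothesis setup : MacLane_setup C r.
Implicit Types x y : G.

Definition zspan (b : nat -> G) (x : G) :=
  exists c : nat -> int, x = \sum_(j < rk C) b j *~ c j.

Lemma zspanD b x y : zspan b x -> zspan b y -> zspan b (x + y).
Proof.
case=> c -> [d ->]; exists (fun j => c j + d j); rewrite -big_split.
by apply: eq_bigr => j _; rewrite mulrzDr.
Qed.

Lemma zspan_mulrz b x (n : int) : zspan b x -> zspan b (x *~ n).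
Proof.
case=> c ->; exists (fun j => c j * n); rewrite mulrz_suml.
by apply: eq_bigr => j _; rewrite mulrzA.
Qed.

Lemma zspan0 b : zspan b 0.
Proof. by exists (fun=> 0); rewrite big1 // => j _; rewrite mulr0z. Qed.

Lemma zspan_sum b n (F : nat -> G) :
  (forall j, (j < n)%N -> zspan b (F j)) -> zspan b (\sum_(j < n) F j).
Proof.
by move=> h; apply: (big_ind (zspan b)) => [|? ?|j _]; [exact: zspan0|exact: zspanD|exact: h].
Qed.

Lemma zspan_basis b j : (j < rk C)%N -> zspan b (b j).
Proof.
move=> jr; exists (fun k => (k == j)%:Z); rewrite (bigD1 (Ordinal jr)) //= eqxx mulr1z.
rewrite big1 ?addr0 // => k; rewrite -val_eqE /= => /negbTE ->; by rewrite mulr0z.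
Qed.

(* The two combinations are related to x and y by a matrix of determinant 1. *)
Lemma zspan_unimodular b x y (u v l l' : int) : l * v + l' * u = 1 ->
  zspan b (x *~ u - y *~ v) -> zspan b (x *~ l + y *~ l') -> zspan b x /\ zspan b y.
Proof.
move=> e h1 h2; split.
  have -> : x = (x *~ u - y *~ v) *~ l' + (x *~ l + y *~ l') *~ v.
    rewrite -{1}[x]mulr1z -e mulrzBl mulrzDl -!mulrzA mulrzDr.
    by rewrite [l' * v]mulrC [RHS]addrACA [_ + y *~ _]addrC subrr addr0 addrC [u * _]mulrC.
  by apply: zspanD; apply: zspan_mulrz.
have -> : y = (x *~ l + y *~ l') *~ u + (x *~ u - y *~ v) *~ (- l).
  rewrite -{1}[y]mulr1z -e mulrzBl mulrzDl -!mulrzA mulrzDr !mulrN !mulrNz opprK.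
  by rewrite [l * u]mulrC [RHS]addrACA subrr add0r addrC [v * _]mulrC.
by apply: zspanD; apply: zspan_mulrz.
Qed.

Lemma ee_gt0 i j : (i < r)%N -> (j < rk C)%N -> (0 < ee C i j)%N.
Proof. by move=> ir jr; case: setup => _ _ _ _ [_ /(_ i j ir jr) []]. Qed.

Lemma dd_gt0 i j : (i < r)%N -> (j < rk C)%N -> (0 < dd C i j)%N.
Proof. by move=> ir jr; rewrite gcdn_gt0 ee_gt0. Qed.

Lemma eprimeSE i j : (eprime C i j.+1 = (eprime C i j %/ dd C i j) * ee C i j)%N.
Proof.
rewrite /= -/(dd C i j) muln_divA ?dvdn_gcdl //.
by rewrite divn_mulAC ?dvdn_gcdr.
Qed.

(** [eprime i j] is the least common multiple of the [ee i t] with t < j. This makes the integer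
    divisions in the exponents of [piF] exact. *)
Lemma ee_dvd_eprime i t j : (t < j)%N -> (ee C i t %| eprime C i j)%N.
Proof.
elim: j => // j IH; rewrite ltnS leq_eqVlt => /orP[/eqP ->|/IH h].
  by rewrite eprimeSE dvdn_mull.
by rewrite /= dvdn_mulr.
Qed.

Definition hcoef i m : rat := (hh C i m)%:~R / (ee C i m)%:R.
(** Formally the value of phi_i divided by the first [j] fractional powers of the pi_i, whose power
    of exponent [ll * eprime] enters [piF i.+1 j]. *)
Definition gam_tail i j : G := \sum_(j <= m < rk C) hcoef i m *: iotab C i m.

Lemma gam_tail0 i : (i < r)%N -> gam C i = gam_tail i 0.
Proof.
by move=> ir; rewrite /gam_tail big_mkord; case: setup => _ _ _ _ [/(_ i ir)].
Qed.

Lemma gam_tailS i j : (j < rk C)%N ->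
  gam_tail i j = hcoef i j *: iotab C i j + gam_tail i j.+1.
Proof. by move=> jr; rewrite /gam_tail big_ltn. Qed.

Lemma gam_tail_split i j : (i < r)%N -> (j <= rk C)%N ->
  gam C i = \sum_(t < j) hcoef i t *: iotab C i t + gam_tail i j.
Proof. by move=> ir jr; rewrite gam_tail0 // /gam_tail (big_cat_nat (leq0n j) jr) /= big_mkord. Qed.

Lemma bezout_ell i j : (i < r)%N -> (j < rk C)%N ->
  ll C i j * hh C i j * (eprime C i j)%:Z + ll' C i j * (ee C i j)%:Z = (dd C i j)%:Z.
Proof. by move=> ir jr; case: setup => _ _ _ _ [_ _ /(_ i j ir jr) []]. Qed.

Lemma ee_neq0 i j : (i < r)%N -> (j < rk C)%N -> (ee C i j)%:R != 0 :> rat.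
Proof. by move=> ir jr; rewrite Num.Theory.pnatr_eq0 -lt0n ee_gt0. Qed.

(** Column [j] of Q_i is proportional to the tail of gamma_i below the diagonal; on the diagonal,
    the Bezout relation divided by [ee] splits [dd / ee] as [ll * hh * eprime / ee + ll']. *)
Lemma iotabS_tail i j : (i < r)%N -> (j < rk C)%N ->
  iotab C i.+1 j =
    gam_tail i j *~ (ll C i j * (eprime C i j)%:Z) + iotab C i j *~ ll' C i j.
Proof.
move=> ir jr /=; rewrite -(big_mkord xpredT (fun m => Qcoef C i m j *: iotab C i m)).
rewrite (big_cat_nat (leq0n j) (ltnW jr)) /= big_nat big1 ?add0r; last first.
  move=> m /andP[_ mj]; rewrite /Qcoef ltn_eqF // ltnNge ltnW //= scale0r //.
rewrite gam_tailS // big_ltn // /Qcoef eqxx.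
have -> : \sum_(j.+1 <= m < rk C) (if m == j then (dd C i j)%:R / (ee C i j)%:R
   else if (j < m)%N then (ll C i j)%:~R * (eprime C i j)%:R * (hh C i m)%:~R / (ee C i m)%:R
   else 0) *: iotab C i m = gam_tail i j.+1 *~ (ll C i j * (eprime C i j)%:Z).
  rewrite /gam_tail mulrz_suml big_nat [RHS]big_nat; apply: eq_bigr => m /andP[jm _].
  rewrite gtn_eqF // jm -scaler_int scalerA /hcoef; congr (_ *: _).
  by rewrite intrM -pmulrn -!mulrA.
rewrite mulrzDl addrAC; congr (_ + _); rewrite -!scaler_int scalerA -scalerDl; congr (_ *: _).
have := congr1 (fun z : int => z%:~R : rat) (bezout_ell ir jr).
rewrite /= -[((dd C i j)%:Z)%:~R]pmulrn => <-.
rewrite intrD !intrM -!pmulrn mulrDl mulfK ?ee_neq0 //; congr (_ + _).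
by rewrite /hcoef; ring.
Qed.

(** The terms and integer coefficients copy the factors and exponents of [piF i.+1 j], so the value
    of that fraction can be read off. *)
Lemma iotabS_value i j : (i < r)%N -> (j < rk C)%N ->
  iotab C i.+1 j = gam C i *~ (ll C i j * (eprime C i j)%:Z) +
    \sum_(t < j) iotab C i t *~ (- (ll C i j * (eprime C i j %/ ee C i t)%:Z * hh C i t)) +
    iotab C i j *~ ll' C i j.
Proof.
move=> ir jr; rewrite iotabS_tail // (gam_tail_split ir (ltnW jr)); congr (_ + _).
rewrite mulrzDl addrAC -[LHS]add0r; congr (_ + _); rewrite mulrz_suml -big_split big1 //= => t _.
rewrite -!scaler_int scalerA -scalerDl.
have tr := ltn_trans (ltn_ord t) jr.
rewrite /hcoef -{1}(divnK (ee_dvd_eprime i (ltn_ord t))).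
rewrite PoszM rmorphN /= !intrM -!pmulrn.
have := ee_neq0 ir tr; set e := _%:R => e0.
have -> : (ll C i j)%:~R * ((eprime C i j %/ ee C i t)%:R * e) * ((hh C i t)%:~R / e) =
  (ll C i j)%:~R * (eprime C i j %/ ee C i t)%:R * (hh C i t)%:~R * (e / e) :> rat by ring.
by rewrite mulfV // mulr1 subrr scale0r.
Qed.

(** Descending in [j], the pair [eprime j * gam_tail j], [iotab i j] is recovered from
    [eprime j.+1 * gam_tail j.+1] and [iotab i.+1 j]. The Bezout relation divided by [dd] says that
    this change has determinant 1. *)
Lemma zspan_iotabS i : (i < r)%N ->
  zspan (iotab C i.+1) (gam C i) /\
  forall j, (j < rk C)%N -> zspan (iotab C i.+1) (iotab C i j).
Proof.
move=> ir.
have step j : (j < rk C)%N ->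
    zspan (iotab C i.+1) (gam_tail i j.+1 *+ eprime C i j.+1) ->
    zspan (iotab C i.+1) (gam_tail i j *+ eprime C i j) /\
    zspan (iotab C i.+1) (iotab C i j).
  move=> jr hj; have d0 := dd_gt0 ir jr.
  apply: (@zspan_unimodular _ _ _ (ee C i j %/ dd C i j)%:Z
    ((eprime C i j %/ dd C i j)%:Z * hh C i j) (ll C i j) (ll' C i j)).
  - have dz : (dd C i j)%:Z != 0 by rewrite -lt0n.
    apply: (mulIf dz); rewrite mul1r -[RHS](bezout_ell ir jr) mulrDl.
    rewrite -[in RHS](divnK (dvdn_gcdl (ee C i j) (eprime C i j))).
    rewrite -[in X in _ = X + _](divnK (dvdn_gcdr (ee C i j) (eprime C i j))).
    by rewrite !PoszM -/(dd C i j); ring.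
  - have -> : gam_tail i j *+ eprime C i j *~ (ee C i j %/ dd C i j)%:Z -
        iotab C i j *~ ((eprime C i j %/ dd C i j)%:Z * hh C i j) =
        gam_tail i j.+1 *+ eprime C i j.+1; last by [].
      rewrite [gam_tail i j *+ _]pmulrn -mulrzA -PoszM -[(_ * (_ %/ _))%N]/(eprime C i j.+1).
      rewrite -pmulrn gam_tailS // mulrnDl addrAC -[RHS]add0r; congr (_ + _).
      rewrite -scaler_nat -scaler_int scalerA -scalerBl eprimeSE /hcoef natrM intrM -pmulrn.
      have -> : (eprime C i j %/ dd C i j)%:R * (ee C i j)%:R *
          ((hh C i j)%:~R / (ee C i j)%:R) = (eprime C i j %/ dd C i j)%:R * (hh C i j)%:~R *
          ((ee C i j)%:R / (ee C i j)%:R) :> rat by ring.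
      by rewrite mulfV ?ee_neq0 // mulr1 subrr scale0r.
  - rewrite [gam_tail i j *+ _]pmulrn -mulrzA [_ * ll _ _ _]mulrC -iotabS_tail //.
    exact: zspan_basis.
(* The descent starts from the empty tail at [rk] and ends at 0, where [eprime] is 1 and the tail is
   gamma_i. *)
have all_tail k : (k <= rk C)%N ->
    zspan (iotab C i.+1) (gam_tail i (rk C - k) *+ eprime C i (rk C - k)).
  elim: k => [_|k IH kr].
    by rewrite subn0 /gam_tail big_geq // mul0rn; apply: zspan0.
  have e : (rk C - k = (rk C - k.+1).+1)%N by rewrite subnSK.
  have lt : (rk C - k.+1 < rk C)%N by rewrite -e leq_subr.
  by apply: (step _ lt _).1; rewrite -e; apply/IH/ltnW.
split.
  by have := all_tail (rk C) (leqnn _); rewrite subnn gam_tail0.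
move=> j jr; apply: (step _ jr _).2.
by have := all_tail (rk C - j.+1)%N (leq_subr _ _); rewrite subKn.
Qed.

Lemma GamIdx_zspan i x : (i <= r)%N -> GamIdx C i x -> zspan (iotab C i) x.
Proof.
elim: i x => [|i IH] x ir [c [z ->]].
  by rewrite big_ord0 addr0; exists c.
have [hg hi] := zspan_iotabS ir.
rewrite big_ord_recr /= addrA; apply: zspanD; last exact: zspan_mulrz.
have [d ->] : zspan (iotab C i) (\sum_(j < rk C) iota0 C j *~ c j + \sum_(t < i) gam C t *~ z t).
  by apply: IH (ltnW ir) _; exists c, z.
by apply: (@zspan_sum _ _ (fun j => iotab C i j *~ d j)) => j jr; apply/zspan_mulrz/hi.
Qed.

(** Freeness is assumed over the integers; the product of the denominators clears a rational
    relation. *)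
Lemma iota0_free_rat (c : nat -> rat) : \sum_(j < rk C) c j *: iota0 C j = 0 ->
  forall j, (j < rk C)%N -> c j = 0.
Proof.
move=> h j jr; pose D := \prod_(k < rk C) denq (c k).
have D0 : D != 0 by apply/prodf_neq0 => k _; apply: denq_neq0.
pose n k := numq (c k * D%:~R).
have nE k : (k < rk C)%N -> c k * D%:~R = (n k)%:~R.
  move=> kr; rewrite /n /D (bigD1 (Ordinal kr)) //= intrM mulrA.
  by rewrite -{1 3}(divq_num_den (c k)) divfK ?intq_eq0 ?denq_neq0 // -intrM numq_int.
case: setup => _ _ _ [_ /(_ n) hn _] _.
have : \sum_(k < rk C) iota0 C k *~ n k = 0.
  rewrite -[RHS](scaler0 _ D%:~R) -[in RHS]h scaler_sumr; apply: eq_bigr => k _.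
  by rewrite -scaler_int -nE // scalerA mulrC.
move/hn => /(_ j jr) nj; have := nE _ jr; rewrite nj => /eqP.
by rewrite mulf_eq0 intq_eq0 (negbTE D0) orbF => /eqP.
Qed.

(** Q_i is lower triangular with nonzero diagonal [dd / ee], so the coefficients vanish one after
    the other in increasing [j]. *)
Lemma iotab_free_rat i (c : nat -> rat) : (i <= r)%N ->
  \sum_(j < rk C) c j *: iotab C i j = 0 -> forall j, (j < rk C)%N -> c j = 0.
Proof.
elim: i c => [|i IH] c ir h; first exact: iota0_free_rat h.
have h' : \sum_(m < rk C) (\sum_(j < rk C) c j * Qcoef C i m j) *: iotab C i m = 0.
  rewrite -[RHS]h /=; under [RHS]eq_bigr do rewrite scaler_sumr.
  rewrite exchange_big /=; apply: eq_bigr => m _.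
  by rewrite scaler_suml; apply: eq_bigr => j _; rewrite scalerA.
have hm := IH (fun m => \sum_(j < rk C) c j * Qcoef C i m j) (ltnW ir) h'.
move=> j; have [n] := ubnP j; elim: n j => // n IHn j jn jr.
have := hm j jr; rewrite (bigD1 (Ordinal jr)) //= big1 ?addr0.
  rewrite /Qcoef eqxx => /eqP; rewrite mulf_eq0 => /orP[/eqP //|].
  by rewrite mulf_eq0 invr_eq0 (negbTE (ee_neq0 ir jr)) orbF Num.Theory.pnatr_eq0 -leqn0 leqNgt dd_gt0.
move=> k; rewrite -val_eqE /= => kj; rewrite /Qcoef eq_sym (negbTE kj).
case: ltnP => // kj'; last by rewrite mulr0.
by rewrite IHn ?mul0r // (leq_trans kj').
Qed.

Lemma coordsE i x : (i <= r)%N -> GamIdx C i x ->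
  x = \sum_(j < rk C) iotab C i j *~ coords C i x j.
Proof. by move=> ir /(GamIdx_zspan ir) h; apply: (epsilon_spec _ _ h). Qed.

Lemma iotab_coef_inj i (c d : nat -> int) : (i <= r)%N ->
  \sum_(j < rk C) iotab C i j *~ c j = \sum_(j < rk C) iotab C i j *~ d j ->
  forall j, (j < rk C)%N -> c j = d j.
Proof.
move=> ir h j jr.
suff /(@iotab_free_rat i (fun j => (c j - d j)%:~R) ir)/(_ j jr)/eqP : \sum_(j < rk C) (c j - d j)%:~R *: iotab C i j = 0.
  by rewrite intq_eq0 subr_eq0 => /eqP.
under eq_bigr do rewrite scaler_int mulrzBr.
by rewrite sumrB h subrr.
Qed.

Lemma GamIdxD k x y : GamIdx C k x -> GamIdx C k y -> GamIdx C k (x + y).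
Proof.
case=> c [z ->] [c' [z' ->]]; exists (fun j => c j + c' j), (fun j => z j + z' j).
rewrite addrACA -!big_split; congr (_ + _); apply: eq_bigr => j _; by rewrite mulrzDr.
Qed.

Lemma GamIdx_mulrz k x (n : int) : GamIdx C k x -> GamIdx C k (x *~ n).
Proof.
case=> c [z ->]; exists (fun j => c j * n), (fun j => z j * n).
by rewrite mulrzDl !mulrz_suml; congr (_ + _); apply: eq_bigr => j _; rewrite mulrzA.
Qed.

Lemma GamIdxN k x : GamIdx C k x -> GamIdx C k (- x).
Proof. by rewrite -mulrN1z; apply: GamIdx_mulrz. Qed.

End Bases.


(** * Homogeneous elements of the graded algebra *)

Section Homogeneous.
Variables (K : fieldType) (G : lmodType rat) (C : chain K G).
Hypothesis oC : group_order C.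
Variable mu : {poly K} -> G.
Hypothesis muV : valuation C mu.
Implicit Types (f g h p : {poly K}) (al be : G) (a b : gr K G) (q : {fraction {poly K}}).
Local Notation tof := (@FracField.tofrac {poly K}).

(** [p] may be 0 or have value above [al]; [a] is then zero in the graded algebra. This covers the
    vanishing coefficients of the residual polynomial. *)
Definition homogeneous a al p := [/\ valid C mu a, Pge C mu al p &
  forall be, Pgt C mu be (gcomp a be - (if be == al then p else 0))].

Lemma homogeneous_single al p : Pge C mu al p -> homogeneous [:: (al, p)] al p.
Proof.
move=> h; split=> //; first by rewrite /valid /= andbT.
by move=> be; rewrite comp_single subrr Pgt0.
Qed.

Lemma homogeneous_Hmu f : f != 0 -> homogeneous (Hmu mu f) (mu f) f.
Proof. by move=> f0; rewrite /Hmu (negbTE f0); apply/homogeneous_single/Pge_refl. Qed.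

Lemma homogeneous_zero al : homogeneous (gzero K G) al 0.
Proof. by split=> // [|be]; rewrite ?Pge0 // /Defs.comp big_nil if_same subrr Pgt0. Qed.

Lemma homogeneous_one : homogeneous (gone K G) 0 1.
Proof. by apply: homogeneous_single; rewrite -(valuation1 muV) Pge_refl. Qed.

Lemma homogeneous_cat a b al p p' : homogeneous a al p -> homogeneous b al p' ->
  homogeneous (a ++ b) al (p + p').
Proof.
case=> va ha ca [vb hb cb]; split; first by rewrite /valid all_cat; apply/andP.
  exact: PgeD.
move=> be; have := PgtD oC muV (ca be) (cb be); rewrite comp_cat.
by case: eqP => _; rewrite !(subr0, addrA) // opprD addrACA !addrA.
Qed.

Lemma homogeneous_mul a b al be p p' : homogeneous a al p -> homogeneous b be p' ->
  homogeneous (gmul a b) (al + be) (p * p').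
Proof.
case=> va ha ca [vb hb cb]; split; [|exact: PgeM|].
  apply/allP => z /allpairsP [[x y] /= [xa yb ->]] /=.
  exact: PgeM (allP va x xa) (allP vb y yb).
move=> g; rewrite comp_gmul.
(* The factors are replaced one at a time: first the components of [b] by [p'], with an error
   bounded termwise by validity of [a], then those of [a] by [p]. *)
have -> : \sum_(x <- a) x.2 * gcomp b (g - x.1) =
    \sum_(x <- a) x.2 * (gcomp b (g - x.1) - (if g - x.1 == be then p' else 0)) +
    gcomp a (g - be) * p'.
  rewrite /gcomp mulr_suml [X in _ + X]big_mkcond -big_split /=; apply: eq_bigr => x _.
  rewrite mulrBr -addrA -[LHS]addr0; congr (_ + _).
  have -> : (x.1 == g - be) = (g - x.1 == be) by rewrite eq_sym !subr_eq addrC.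
  by case: ifP; rewrite ?mulr0 ?subrr ?addNr ?oppr0 ?addr0.
rewrite -addrA; apply: PgtD => //.
  rewrite big_seq; apply: Pgt_sum => // x xa.
  rewrite -[X in Pgt _ _ X _](subrKC x.1); apply: PgtMr => //; first exact: (allP va x xa).
have -> : gcomp a (g - be) * p' - (if g == al + be then p * p' else 0) =
    (gcomp a (g - be) - (if g - be == al then p else 0)) * p'.
  by rewrite subr_eq; case: eqP; rewrite ?subr0 // mulrBl.
by rewrite -[X in Pgt _ _ X _](subrK be); apply: PgtMl => //; apply: ca.
Qed.

Lemma homogeneous_exp a al p n : homogeneous a al p -> homogeneous (gexp a n) (al *+ n) (p ^+ n).
Proof.
move=> h; elim: n => [|n IH] /=; first exact: homogeneous_one.
by rewrite mulrS exprS; apply: homogeneous_mul.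
Qed.

Lemma homogeneous_sum (I : Type) (s : seq I) (a : I -> gr K G) al (p : I -> {poly K}) :
  (forall i, homogeneous (a i) al (p i)) ->
  homogeneous (gsum [seq a i | i <- s]) al (\sum_(i <- s) p i).
Proof.
move=> h; elim: s => [|i s IH] /=; first by rewrite big_nil; apply: homogeneous_zero.
by rewrite big_cons; apply: homogeneous_cat.
Qed.

Lemma homogeneous_greq a b al p p' : homogeneous a al p -> homogeneous b al p' ->
  Pgt C mu al (p - p') -> greq C mu a b.
Proof.
case=> _ _ ca [_ _ cb] h; apply/greqP => be.
have := PgtB oC muV (ca be) (cb be); case: eqP => [->|_]; last by rewrite !subr0.
move=> h'; have := PgtD oC muV h' h; congr (Pgt _ _ _ _).
by ring.
Qed.

(* q is a quotient of polynomials whose initial form is that of the polynomial p of value al *)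
Definition represents al q p := [/\ p != 0, mu p = al &
  exists g h, [/\ h != 0, q = tof g / tof h & Pgt C mu (al + mu h) (p * h - g)]].

Lemma tofrac_neq0 h : h != 0 -> tof h != 0.
Proof. by move=> h0; rewrite tofrac_eq0. Qed.

(** The estimate holds for every way of writing [q], by cross-multiplication. This is needed because
    [Hfrac] chooses its own numerator and denominator. *)
Lemma represents_any al q p g h : represents al q p -> h != 0 -> q = tof g / tof h ->
  Pgt C mu (al + mu h) (p * h - g).
Proof.
case=> p0 vp [g' [h' [h'0 e' hp]]] h0 e.
have eg : g' * h = g * h'.
  apply/eqP; rewrite -tofrac_eq !tofracM; apply/eqP.
  by apply: (canRL (divfK (tofrac_neq0 h'0))); rewrite mulrAC -e' e divfK ?tofrac_neq0.
rewrite -(Pgt_mulE oC muV _ _ h'0).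
have -> : h' * (p * h - g) = (p * h' - g') * h by rewrite mulrBr [h' * g]mulrC -eg; ring.
by rewrite addrCA addrA; apply: PgtMl => //; apply: Pge_refl.
Qed.

Lemma represents_num al q p g h : represents al q p -> h != 0 -> q = tof g / tof h ->
  g != 0 /\ mu g = al + mu h.
Proof.
move=> rq h0 e; have [p0 vp _] := rq; rewrite -vp -(valuationM muV) //.
apply: (value_close oC muV); first exact: mulf_neq0.
by rewrite (valuationM muV) // vp; apply: represents_any rq h0 e.
Qed.

Lemma represents_tofrac f : f != 0 -> represents (mu f) (tof f) f.
Proof.
move=> f0; split=> //; exists f, 1.
by rewrite oner_neq0 tofrac1 divr1 mulr1 subrr Pgt0.
Qed.

Lemma represents_mul al be q q' p p' : represents al q p -> represents be q' p' ->
  represents (al + be) (q * q') (p * p').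
Proof.
move=> r1 r2; have [p0 vp [g [h [h0 e hp]]]] := r1.
have [p'0 vp' [g' [h' [h'0 e' hp']]]] := r2.
split; [exact: mulf_neq0 | by rewrite (valuationM muV) // vp vp' |].
exists (g * g'), (h * h'); split; first exact: mulf_neq0.
  by rewrite e e' !tofracM mulf_div.
have -> : p * p' * (h * h') - g * g' = (p * h - g) * (p' * h') + g * (p' * h' - g') by ring.
rewrite (valuationM muV) // addrACA; apply: PgtD => //.
  by apply: PgtMl => //; rewrite Pge_nz ?mulf_neq0 // (valuationM muV) // vp' (le_gg oC).
by apply: PgtMr => //; have [g0 <-] := represents_num r1 h0 e; apply: Pge_refl.
Qed.

Lemma represents_exp al q p n : represents al q p -> represents (al *+ n) (q ^+ n) (p ^+ n).
Proof.
move=> rq; elim: n => [|n IH].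
  by have := represents_tofrac (oner_neq0 _); rewrite tofrac1 (valuation1 muV).
by rewrite mulrS !exprS; apply: represents_mul.
Qed.

(** The polynomial [p] shows that the choice in [Hfrac] is not vacuous. Whatever [z] is chosen, [z]
    and [p] have the same product with the initial form of a denominator, and this factor
    cancels. *)
Lemma homogeneous_Hfrac al q p : represents al q p -> homogeneous (Hfrac C mu q) al p.
Proof.
move=> rq; have [p0 vp [g [h [h0 e hp]]]] := rq.
have hsingle z h' be : h' != 0 ->
    gcomp (gmul z (Hmu mu h')) be = gcomp z (be - mu h') * h'.
  move=> h'0; rewrite comp_gmul /Hmu (negbTE h'0) /gcomp mulr_suml [RHS]big_mkcond /=.
  apply: eq_bigr => x _; rewrite -/(gcomp _ _) comp_single.
  have -> : (x.1 == be - mu h') = (be - x.1 == mu h') by rewrite eq_sym !subr_eq addrC.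
  by case: ifP; rewrite ?mulr0.
have HE f be : f != 0 -> gcomp (Hmu mu f) be = if be == mu f then f else 0.
  by move=> f0; rewrite /Hmu (negbTE f0) comp_single.
have ex : exists z, valid C mu z /\ exists g h : {poly K},
    h != 0 /\ q = FracField.tofrac g / FracField.tofrac h /\
    greq C mu (gmul z (Hmu mu h)) (Hmu mu g).
  exists [:: (al, p)]; split; first by rewrite /valid /= vp (le_gg oC) orbT.
  exists g, h; split=> //; split=> //; have [g0 vg] := represents_num rq h0 e.
  apply/greqP => be; rewrite hsingle // HE // comp_single vg subr_eq.
  by case: eqP => [->|_]; rewrite ?mul0r ?subrr ?Pgt0.
have := epsilon_spec (inhabits (gzero K G)) _ ex; rewrite -/(Hfrac C mu q).
case=> vz [g' [h' [h'0 [e' /greqP hz]]]]; have [g'0 vg'] := represents_num rq h'0 e'.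
split=> //; first by rewrite -vp Pge_refl.
move=> be; have := hz (be + mu h'); rewrite hsingle // HE // addrK vg' (inj_eq (addIr _)).
move=> hz'; rewrite -(Pgt_mulE oC muV _ _ h'0) [mu h' + be]addrC; move: hz'.
case: eqP => [->|_]; last by rewrite !subr0 mulrC.
move=> h1; have := PgtB oC muV h1 (represents_any rq h'0 e'); congr (Pgt _ _ _ _).
by ring.
Qed.

Definition has_unit_rep al q := exists2 p, represents al q p & munit C mu p.

Lemma has_unit_rep_tofrac f : munit C mu f -> has_unit_rep (mu f) (tof f).
Proof. by move=> uf; exists f => //; apply: represents_tofrac; case: uf. Qed.

Lemma has_unit_rep1 : has_unit_rep 0 1.
Proof.
rewrite -(valuation1 muV) -tofrac1; apply: has_unit_rep_tofrac; split; first exact: oner_neq0.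
by exists 1; rewrite ?oner_neq0 // mulr1 subrr Pgt0.
Qed.

Lemma munitM f g : munit C mu f -> munit C mu g -> munit C mu (f * g).
Proof.
case=> f0 [f' f'0 hf] [g0 [g' g'0 hg]]; split; first exact: mulf_neq0.
exists (f' * g'); first exact: mulf_neq0.
have -> : f * g * (f' * g') - 1 = (f * f' - 1) * (g * g') + (g * g' - 1) by ring.
apply: PgtD => //; rewrite -[0]addr0; apply: PgtMl => //.
rewrite Pge_nz ?mulf_neq0 // (valuationM muV) // (munit_inv_val oC muV g0 g'0 hg).
by rewrite subrr (le_gg oC).
Qed.

Lemma has_unit_repM al be q q' : has_unit_rep al q -> has_unit_rep be q' ->
  has_unit_rep (al + be) (q * q').
Proof.
case=> p rp up [p' rp' up']; exists (p * p'); [exact: represents_mul | exact: munitM].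
Qed.

(** The polynomial inverse [p'] of [p] follows the inverse fraction, since [p' * g - h] combines the
    errors [p * h - g] and [p * p' - 1]. *)
Lemma has_unit_repV al q : has_unit_rep al q -> has_unit_rep (- al) q^-1.
Proof.
case=> p rp [p0 [p' p'0 hp]]; have vp' := munit_inv_val oC muV p0 p'0 hp.
exists p'; last by split=> //; exists p => //; rewrite mulrC.
have [_ vp [g [h [h0 e hph]]]] := rp; have [g0 vg] := represents_num rp h0 e.
split=> //; first by rewrite vp' vp.
exists h, g; split=> //; first by rewrite e invf_div.
have -> : p' * g - h = p' * - (p * h - g) + (p * p' - 1) * h by ring.
rewrite vg addKr; apply: PgtD => //.
  rewrite -(addKr al (mu h)) -vp -vp' vp; apply: PgtMr => //; first exact: Pge_refl.
  by rewrite (PgtN muV).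
by rewrite -[mu h]add0r; apply: PgtMl => //; apply: Pge_refl.
Qed.

Lemma has_unit_rep_exprz al q (n : int) : has_unit_rep al q -> has_unit_rep (al *~ n) (q ^ n).
Proof.
move=> hq; have hn m : has_unit_rep (al *+ m) (q ^+ m).
  elim: m => [|m IH]; first by rewrite mulr0n expr0; apply: has_unit_rep1.
  by rewrite mulrS exprS; apply: has_unit_repM.
case: n => m; first by rewrite -pmulrn -exprnP.
by rewrite NegzE mulrNz -pmulrn -exprz_inv -exprnP exprVn; apply: has_unit_repV.
Qed.

Lemma has_unit_rep_prod n (al : nat -> G) (q : nat -> {fraction {poly K}}) :
  (forall j, (j < n)%N -> has_unit_rep (al j) (q j)) ->
  has_unit_rep (\sum_(j < n) al j) (\prod_(j < n) q j).
Proof.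
elim: n => [|n IH] h; first by rewrite !big_ord0; apply: has_unit_rep1.
rewrite !big_ord_recr /=; apply: has_unit_repM; last exact: h.
by apply: IH => j jn; apply: h; apply: ltnW.
Qed.

End Homogeneous.

(** * The fractions pi as units in the graded algebra of mu_r *)

Section PiUnits.
Variables (K : fieldType) (G : lmodType rat) (C : chain K G) (r : nat).
Hypothesis setup : MacLane_setup C r.
Let oC := setup_order setup.
Let muV := muc_valuation setup (leqnn r).
Local Notation mu := (muc C r.+1).
Local Notation tof := (@FracField.tofrac {poly K}).

Lemma has_unit_rep_neq0 al q : has_unit_rep C mu al q -> q != 0.
Proof.
case=> p rp _; have [_ _ [g [h [h0 e _]]]] := rp.
have [g0 _] := represents_num oC muV rp h0 e.
by rewrite e mulf_neq0 ?invr_eq0 ?tofrac_eq0.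
Qed.

Lemma has_unit_rep_piF i j : (i <= r)%N -> (j < rk C)%N ->
  has_unit_rep C mu (iotab C i j) (piF C i j).
Proof.
elim: i j => [|i IH] j ir jr.
  rewrite /=; case: setup => _ _ _ _ [_ _ _ /(_ j jr) [p0 <-]].
  by rewrite -(muc_const setup (leqnn r) p0); apply: has_unit_rep_tofrac => //; apply: (@munit_const _ _ C r.+1).
rewrite (iotabS_value setup ir jr); apply: has_unit_repM => //.
  apply: has_unit_repM => //.
    apply: has_unit_rep_exprz => //.
    have [u <-] := munit_phi setup (i := i) (k := r) (introT andP (conj ir (leqnn r))).
    exact: has_unit_rep_tofrac.
  pose n t : int := - (ll C i j * (eprime C i j %/ ee C i t)%:Z * hh C i t).
  apply: (@has_unit_rep_prod _ _ _ oC _ muV _ (fun t => iotab C i t *~ n t)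
    (fun t => piF C i t ^ n t)) => t tj.
  by apply: has_unit_rep_exprz => //; apply: IH (ltnW ir) (ltn_trans tj jr).
by apply: has_unit_rep_exprz => //; apply: IH (ltnW ir) jr.
Qed.

Lemma has_unit_rep_pipow x : GamIdx C r x -> has_unit_rep C mu x (pipow C r x).
Proof.
move=> hx; rewrite {1}(coordsE setup (leqnn r) hx).
apply: (@has_unit_rep_prod _ _ _ oC _ muV _ (fun j => iotab C r j *~ coords C r x j)
    (fun j => piF C r j ^ coords C r x j)) => j jr.
by apply: has_unit_rep_exprz => //; apply: has_unit_rep_piF.
Qed.

(** Freeness of the basis forces the chosen exponents to cancel coordinate by coordinate; the
    relation thus holds between fractions, not merely between initial forms. *)
Lemma pipow_relation x y z n : GamIdx C r x -> GamIdx C r y -> GamIdx C r z ->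
  x + y + z *+ n = 0 -> pipow C r x * pipow C r y * pipow C r z ^+ n = 1.
Proof.
move=> hx hy hz e.
have ec j : (j < rk C)%N -> coords C r x j + coords C r y j + coords C r z j * n%:Z = 0.
  move=> jr; apply: (@iotab_coef_inj _ _ _ _ setup r
    (fun j => coords C r x j + coords C r y j + coords C r z j * n%:Z) (fun=> 0)) => //.
  rewrite [RHS]big1 => [|k _]; last by rewrite mulr0z.
  have hc u : GamIdx C r u -> \sum_(j < rk C) iotab C r j *~ coords C r u j = u.
    by move=> hu; rewrite -(coordsE setup (leqnn r) hu).
  transitivity (x + y + z *~ n); last by rewrite -pmulrn e.
  rewrite -[x in RHS]hc // -[y in RHS]hc // -[z in RHS]hc // mulrz_suml -!big_split /=.
  by apply: eq_bigr => k _; rewrite !mulrzDr mulrzA.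
rewrite /pipow -prodrXl -!big_split big1 //= => j _.
have p0 := has_unit_rep_neq0 (has_unit_rep_piF (leqnn r) (ltn_ord j)).
by rewrite exprnP exprz_exp -!expfzDr // ec.
Qed.

End PiUnits.

(** * The Newton polygon *)

Section OrderScale.
Variables (K : fieldType) (G : lmodType rat) (C : chain K G).
Hypothesis oC : group_order C.
Implicit Types x y : G.

(** The order is only assumed compatible with addition, so a rational factor is treated by
    multiplying by its denominator. *)
Lemma le_g_scale (q : rat) x : 0 <= q -> le C 0 x -> le C 0 (q *: x).
Proof.
move=> q0 x0; rewrite (gle_ngt oC) -[0]oppr0 -[q *: x]opprK (glt_N2 oC); apply/negP => h.
have d0 : (0 < `|denq q|)%N by rewrite absz_gt0 denq_neq0.
have := glt_mulrn oC d0 h; rewrite -scaler_nat scalerN scalerA.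
have -> : (`|denq q|%N)%:R * q = (`|numq q|%N)%:R :> rat.
  rewrite -{2}[q]divq_num_den mulrC.
  have -> : `|denq q|%:R = (denq q)%:~R :> rat by rewrite pmulrn gez0_abs ?denq_ge0.
  rewrite divfK ?intq_eq0 ?denq_neq0 //.
  by rewrite pmulrn gez0_abs // numq_ge0.
rewrite scaler_nat => h'; have := le_g_mulrn oC `|numq q| x0.
by rewrite (gle_ngt oC) -[0]oppr0 -[x *+ _]opprK (glt_N2 oC) h'.
Qed.

Lemma le_g_sum n (F : 'I_n -> G) : (forall k, le C 0 (F k)) -> le C 0 (\sum_k F k).
Proof.
move=> h; apply: (big_ind (fun x => le C 0 x)) => [|x y hx hy|k _]; rewrite ?(le_gg oC) //.
by rewrite -[0]addr0 le_gD.
Qed.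

Lemma g_sum_eq0 n (F : 'I_n -> G) : (forall k, le C 0 (F k)) -> \sum_k F k = 0 ->
  forall k, F k = 0.
Proof.
move=> h e k; apply: (le_g_anti oC) => //; rewrite -e (bigD1 k) //=.
rewrite -{1}[F k]addr0 (le_gD2l oC).
by rewrite big_mkcond; apply: le_g_sum => j; case: ifP => _ //; apply: le_gg.
Qed.

End OrderScale.

Lemma conv_pt_mix (G : lmodType rat) (pts : seq (nat * G)) (l t t' : rat) (w w' : G) :
  0 <= l -> 0 <= 1 - l -> conv_pt pts t w -> conv_pt pts t' w' ->
  conv_pt pts (l * t + (1 - l) * t') (l *: w + (1 - l) *: w').
Proof.
move=> l0 l1 [c [c0 [c1 [-> ->]]]] [d [d0 [d1 [-> ->]]]].
exists (fun k => l * c k + (1 - l) * d k); split; [|split; [|split]].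
- by move=> k; rewrite Num.Theory.addr_ge0 ?Num.Theory.mulr_ge0.
- by rewrite big_split -!mulr_sumr c1 d1 /=; ring.
- rewrite !mulr_sumr -big_split; apply: eq_bigr => k _ /=; ring.
- rewrite !scaler_sumr -big_split; apply: eq_bigr => k _ /=.
  by rewrite !scalerA -scalerDl.
Qed.

Lemma conv_pt_vertex (G : lmodType rat) (pts : seq (nat * G)) (z : nat * G) :
  z \in pts -> conv_pt pts z.1%:R z.2.
Proof.
move=> hz; have iz : (index z pts < size pts)%N by rewrite index_mem.
exists (fun k => (k == index z pts)%:R); split; first by move=> k; rewrite Num.Theory.ler0n.
have nz k : k != Ordinal iz -> (val k == index z pts) = false.
  by rewrite -val_eqE => /negbTE.
split; [|split].
- by rewrite (bigD1 (Ordinal iz)) //= eqxx big1 ?addr0 // => k /nz /= ->.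
- rewrite (bigD1 (Ordinal iz)) //= eqxx mul1r nth_index // big1 ?addr0 // => k /nz /= ->.
  by rewrite mul0r.
- rewrite (bigD1 (Ordinal iz)) //= eqxx scale1r nth_index // big1 ?addr0 // => k /nz /= ->.
  by rewrite scale0r.
Qed.

Section Newton.
Variables (K : fieldType) (G : lmodType rat) (C : chain K G) (r : nat).
Hypothesis setup : MacLane_setup C r.
Let oC := setup_order setup.
Let aug := muc_augmentable setup (leqnn r).
Let p1 := aug_size aug.
Variable f : {poly K}.
Hypothesis f0 : f != 0.
Local Notation a s := (coefs (phi C r) f s).
Local Notation M := (muc C r.+1 f).

(** The terms attaining mu(f): an algebraic form of lying on the side of slope minus gamma_r, free
    of convex hulls and of [epsilon]. *)
Definition on_side s := (a s != 0) && (muc C r (a s) + gam C r *+ s == M).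

Lemma on_side_ex : exists s, on_side s.
Proof.
by have [s hs e] := augment_attained oC aug f0; exists s; rewrite /on_side hs /= e eqxx.
Qed.

Lemma on_side_size s : on_side s -> (s <= size f)%N.
Proof. by case/andP => h _; rewrite leqNgt; apply: contra h => /ltnW h; rewrite coefs_ge. Qed.

Definition side_left := ex_minn on_side_ex.
Definition side_right := ex_maxn on_side_ex on_side_size.

Lemma side_leftP : on_side side_left /\ forall s, on_side s -> (side_left <= s)%N.
Proof. by rewrite /side_left; case: ex_minnP. Qed.

Lemma side_rightP : on_side side_right /\ forall s, on_side s -> (s <= side_right)%N.
Proof. by rewrite /side_right; case: ex_maxnP. Qed.

Lemma mem_npts z : reflect (exists2 s, a s != 0 & z = (s, muc C r (a s))) (z \in npts C r f).
Proof.
apply: (iffP mapP) => [[s]|[s hs ->]].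
  by rewrite mem_filter => /andP[hs _] ->; exists s.
exists s => //; rewrite mem_filter hs mem_iota size_phiexp /= add0n ltnNge.
by apply: contra hs => h; rewrite coefs_ge.
Qed.

(** The form w + t gamma_r at a convex combination averages the values of the terms of [f], all at
    least mu(f). Equality puts all the weight on terms of least value, which lie between the two
    extreme ones. *)
Lemma conv_npts t w : conv_pt (npts C r f) t w ->
  le C M (w + t *: gam C r) /\
  (w + t *: gam C r = M -> side_left%:R <= t /\ t <= side_right%:R).
Proof.
case=> c [c0 [c1 [et ew]]].
set n := size _ in c1 et ew; pose Q (k : 'I_n) := nth (0%N, 0) (npts C r f) k.
have Qp k : exists2 s, a s != 0 & Q k = (s, muc C r (a s)) by apply/mem_npts/mem_nth.
pose F (k : 'I_n) := c k *: ((Q k).2 + gam C r *+ (Q k).1 - M).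
have F0 k : le C 0 (F k).
  apply: (le_g_scale oC) => //; have [s hs ->] := Qp k.
  by rewrite -(le_gD2r oC M) add0r subrK; apply: (augment_le oC).
have e : w + t *: gam C r = M + \sum_k F k.
  apply/eqP; rewrite addrC [M + _]addrC -subr_eq addrC; apply/eqP.
  have -> : - M = \sum_(k < n) - (c k *: M) by rewrite sumrN -scaler_suml c1 scale1r.
  rewrite ew et scaler_suml -!big_split; apply: eq_bigr => k _ /=.
  by rewrite /F scalerBr scalerDr -scaler_nat scalerA.
split; first by rewrite e -{1}[M]addr0 (le_gD2l oC); apply: le_g_sum.
rewrite e -[RHS]addr0 => /addrI /(g_sum_eq0 oC F0) Fk.
have on (k : 'I_n) : c k != 0 -> on_side (Q k).1.
  move=> ck; have/eqP := Fk k; rewrite /F scaler_eq0 (negbTE ck) subr_eq0 /=.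
  by have [s hs ->] := Qp k; rewrite /on_side hs.
have bound (b b' : rat) : (forall k : 'I_n, c k != 0 -> b <= (Q k).1%:R <= b') -> b <= t <= b'.
  have cb (x : rat) : x = \sum_(k < n) c k * x by rewrite -mulr_suml c1 mul1r.
  move=> h; rewrite et (cb b) (cb b'); apply/andP; split;
    apply: Num.Theory.ler_sum => k _; case: (eqVneq (c k) 0) => [->|ck]; rewrite ?mul0r //;
    by apply: Num.Theory.ler_wpM2l => //; case/andP: (h k ck).
apply/andP; apply: bound => k /on hk; rewrite !Num.Theory.ler_nat.
by rewrite (proj2 side_leftP) ?(proj2 side_rightP).
Qed.

Lemma on_side_value s : on_side s -> muc C r (a s) + s%:R *: gam C r = M.
Proof. by rewrite scaler_nat => /andP[_ /eqP]. Qed.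

Lemma on_side_inS s : on_side s -> inS C r f s%:R (muc C r (a s)).
Proof.
move=> hs; have [as0 _] := andP hs; have e := on_side_value hs.
split; first split.
- by apply: (@conv_pt_vertex _ _ (s, _)); apply/mem_npts; exists s.
- by move=> w' /conv_npts [+ _]; rewrite -e (le_gD2r oC).
- by move=> t' w' [/conv_npts [+ _] _]; rewrite e.
Qed.

Lemma inS_value t w : inS C r f t w -> w + t *: gam C r = M.
Proof.
case=> [[/conv_npts [h _] _] hmin]; have [hl _] := side_leftP.
have := hmin _ _ (proj1 (on_side_inS hl)); rewrite on_side_value // => h'.
exact: (le_g_anti oC).
Qed.

Lemma inS_bounds t w : inS C r f t w -> side_left%:R <= t /\ t <= side_right%:R.
Proof. by move=> h; have [[/conv_npts [_ h'] _] _] := h; apply/h'/(inS_value h). Qed.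

(** The specification behind [epsilon] has a single solution, because the abscissas of the side are
    bounded by vertices that belong to it. *)
Lemma sL_eq : sL C r f = side_left.
Proof.
have [hl ml] := side_leftP.
have ex : exists s : nat, (exists u, inS C r f s%:R u) /\ forall t w, inS C r f t w -> s%:R <= t.
  exists side_left; split; first by eexists; apply: on_side_inS hl.
  by move=> t w /inS_bounds [].
have := epsilon_spec (inhabits 0%N) _ ex; rewrite -/(sL C r f) => -[[u hu] hm].
apply/eqP; rewrite eqn_leq -!(Num.Theory.ler_nat rat); apply/andP; split.
  exact: hm (on_side_inS hl).
by case: (inS_bounds hu).
Qed.

Lemma sR_eq : sR C r f = side_right.
Proof.
have [hl ml] := side_rightP.
have ex : exists s : nat, (exists u, inS C r f s%:R u) /\ forall t w, inS C r f t w -> t <= s%:R.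
  exists side_right; split; first by eexists; apply: on_side_inS hl.
  by move=> t w /inS_bounds [].
have := epsilon_spec (inhabits 0%N) _ ex; rewrite -/(sR C r f) => -[[u hu] hm].
apply/eqP; rewrite eqn_leq -!(Num.Theory.ler_nat rat); apply/andP; split.
  by case: (inS_bounds hu).
exact: hm (on_side_inS hl).
Qed.

Lemma uL_eq : uL C r f = muc C r (a side_left).
Proof.
have [hl _] := side_leftP.
have ex : exists u, inS C r f (sL C r f)%:R u.
  by rewrite sL_eq; eexists; apply: on_side_inS hl.
have := inS_value (epsilon_spec (inhabits 0) _ ex); rewrite -/(uL C r f) sL_eq.
by rewrite -(on_side_value hl) => /addIr.
Qed.

(** [Rcoef] tests membership in the whole polygon, whereas least value means lying on the side.
    Between the endpoints the two agree, since the segment joining them bounds the lower hull from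
    above. *)
Lemma onN_on_side s : (side_left <= s <= side_right)%N -> a s != 0 ->
  onN C r f s%:R (muc C r (a s)) <-> on_side s.
Proof.
move=> /andP[ls sr] as0; split; last by move=> /on_side_inS [].
move=> [_ hmin]; rewrite /on_side as0 andTb -(scaler_nat s (gam C r)).
have [hl _] := side_leftP; have [hr _] := side_rightP.
have [cl _] := on_side_inS hl; have [cr _] := on_side_inS hr.
have [l [l0 l1 es]] : exists l : rat, [/\ 0 <= l, 0 <= 1 - l &
    s%:R = l * side_left%:R + (1 - l) * side_right%:R].
  case: (eqVneq side_left side_right) => [e|ne].
    exists 1; rewrite subrr mul0r mul1r addr0 Num.Theory.ler01 Order.POrderTheory.lexx; split => //.
    by congr (_%:R); apply/eqP; rewrite eqn_leq ls e sr.
  have d0 : (0 : rat) < side_right%:R - side_left%:R.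
    by rewrite Num.Theory.subr_gt0 Num.Theory.ltr_nat ltn_neqAle ne (leq_trans ls).
  have dn : side_right%:R - side_left%:R != 0 :> rat by rewrite Order.POrderTheory.gt_eqF.
  exists ((side_right%:R - s%:R) / (side_right%:R - side_left%:R)).
  have e1 : 1 - (side_right%:R - s%:R) / (side_right%:R - side_left%:R) =
    (s%:R - side_left%:R) / (side_right%:R - side_left%:R) :> rat by field.
  rewrite e1; split; rewrite ?Num.Theory.divr_ge0 ?Num.Theory.subr_ge0 ?Num.Theory.ler_nat
    ?(leq_trans ls sr) //.
  by field.
have := hmin _ (eq_ind _ (fun t => conv_pt _ t _) (conv_pt_mix l0 l1 (proj1 cl) (proj1 cr)) _ (esym es)).
set w := _ *: _ + _ => hw.
have ew : w + s%:R *: gam C r = M.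
  rewrite es scalerDl addrACA -!scalerA -!scalerDr !on_side_value // -scalerDl.
  by rewrite addrC subrK scale1r.
apply/eqP; apply: (le_g_anti oC); first by rewrite -ew (le_gD2r oC).
have c : conv_pt (npts C r f) s%:R (muc C r (a s)).
  by apply: (@conv_pt_vertex _ _ (s, _)); apply/mem_npts; exists s.
by case: (conv_npts c).
Qed.

End Newton.

(** * The residual polynomial *)

Section Residual.
Variables (K : fieldType) (G : lmodType rat) (C : chain K G) (r : nat).
Hypothesis setup : MacLane_setup C r.
Let oC := setup_order setup.
Let aug := muc_augmentable setup (leqnn r).
Let p1 := aug_size aug.
Let muV := muc_valuation setup (leqnn r).
Variable f : {poly K}.
Hypothesis f0 : f != 0.
Hypothesis fatt : GamIdx C r.+1 (muc C r.+1 f).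
Local Notation p := (phi C r).
Local Notation a s := (coefs (phi C r) f s).
Local Notation mu := (muc C r.+1).
Local Notation nu := (muc C r).
Local Notation M := (muc C r.+1 f).
Local Notation e := (eidx C r).
Local Notation s0 := (side_left setup f0).
Local Notation s1 := (side_right setup f0).
Local Notation tof := (@FracField.tofrac {poly K}).

Lemma eidx_gt0 : (0 < e)%N.
Proof. by case: setup => _ _ [_ _ _ /(_ r (leqnn r)) []]. Qed.

Lemma hbig_GamIdx : GamIdx C r (hbig C r).
Proof. by case: setup => _ _ _ [_ _ /(_ r (leqnn r))]. Qed.

Lemma GamMu_coef s : a s != 0 -> GamMu C r (nu (a s)).
Proof. by move=> h; apply: (GamMu_small setup) => //; apply: size_coefs. Qed.

(** Such an [n] is a multiple of e_r, so the element is an integer multiple of h_r, which lies in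
    Gamma_{r-1}. *)
Lemma gam_mulrz_GamIdx (n : int) : GamMu C r (gam C r *~ n) -> GamIdx C r (gam C r *~ n).
Proof.
move/(eidx_dvd setup (leqnn r)) => /dvdzP [q ->].
by rewrite mulrC mulrzA -pmulrn; apply/GamIdx_mulrz/hbig_GamIdx.
Qed.

(** Attainability writes u_r(f) as an element [g] of Gamma_{r-1} plus a multiple of gamma_r. That
    multiple is a difference of elements of Gamma_{mu_{r-1}}, hence itself in Gamma_{r-1}. *)
Lemma side_left_GamIdx : GamIdx C r (nu (a s0)).
Proof.
have [/andP[h0 /eqP hM] _] := side_leftP setup f0.
have [c [z eM]] := fatt; set g := \sum_(j < rk C) iota0 C j *~ c j + \sum_(t < r) gam C t *~ z t.
have hg : GamIdx C r g by exists c, z.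
have eu : nu (a s0) = g + gam C r *~ (z r - s0%:Z).
  apply: (addIr (gam C r *+ s0)); rewrite hM eM big_ord_recr /= mulrzBr -pmulrn.
  by rewrite -!addrA addNr addr0.
rewrite eu; apply: GamIdxD => //; apply: gam_mulrz_GamIdx.
have -> : gam C r *~ (z r - s0%:Z) = nu (a s0) - g by rewrite eu [RHS]addrC addKr.
apply: (GamMuB setup) => //; first exact: GamMu_coef.
exact: (GamIdx_GamMu setup).
Qed.

Lemma on_side_index s : on_side C r f s ->
  exists2 j, s = (s0 + j * e)%N & (j <= (s1 - s0) %/ e)%N.
Proof.
move=> hs; have [h0 hmin] := side_leftP setup f0; have [_ hmax] := side_rightP setup f0.
have [/andP[a0 /eqP e0] /andP[as0 /eqP es]] := conj h0 hs.
have l0 := hmin s hs.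
have : (e%:Z %| (s - s0)%N%:Z)%Z.
  apply: (eidx_dvd setup) => //; rewrite -pmulrn.
  have -> : gam C r *+ (s - s0) = nu (a s0) - nu (a s).
    apply: (addIr (nu (a s) + gam C r *+ s0)).
    by rewrite addrCA -mulrnDr subnK // es -e0 addrA subrK.
  by apply: (GamMuB setup) => //; apply: GamMu_coef.
rewrite dvdzE /= => /dvdnP [j ej].
exists j; first by rewrite -ej subnKC.
by rewrite leq_divRL ?eidx_gt0 // -ej leq_sub2r // hmax.
Qed.

Lemma side_index_le j : (j <= (s1 - s0) %/ e)%N -> (s0 <= s0 + j * e <= s1)%N.
Proof.
move=> hj; rewrite leq_addr /=; have [h0 _] := side_leftP setup f0.
have [_ hmax] := side_rightP setup f0.
rewrite -(subnKC (hmax _ h0)) leq_add2l (leq_trans _ (leq_trunc_div _ e)) //.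
by rewrite leq_mul2r hj orbT.
Qed.

Definition side_coef j : {poly K} :=
  if (j <= (s1 - s0) %/ e)%N && on_side C r f (s0 + j * e) then a (s0 + j * e) else 0.

Lemma size_side_coef j : (size (side_coef j) < size p)%N.
Proof.
by rewrite /side_coef; case: ifP => _; rewrite ?size_coefs // size_poly0 ltnW.
Qed.

(** Every term of least value has an abscissa s0 + j e for exactly one [j] in the range, so the sum
    removes these terms and leaves only digits of larger value. *)
Lemma side_coefs_close :
  Pgt C mu M (f - \sum_(j <- iota 0 ((s1 - s0) %/ e).+1) side_coef j * p ^+ (s0 + j * e)).
Proof.
apply/(Pgt_augment oC aug) => s; rewrite coefsD // coefsN //.
have -> : coefs p (\sum_(j <- iota 0 ((s1 - s0) %/ e).+1) side_coef j * p ^+ (s0 + j * e)) s =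
    \sum_(j <- iota 0 ((s1 - s0) %/ e).+1) if s == (s0 + j * e)%N then side_coef j else 0.
  elim: (iota _ _) => [|j l IH]; first by rewrite !big_nil coefs_zero.
  by rewrite !big_cons coefsD // IH coefs_monomial // size_side_coef.
case: (boolP (on_side C r f s)) => hs.
  have [j0 ej hj] := on_side_index hs.
  rewrite (bigD1_seq j0) ?iota_uniq ?mem_iota //= -ej eqxx /side_coef hj -ej hs /=.
  rewrite big1 ?addr0 ?subrr ?Pgt0 // => j jj; rewrite ej eqn_add2l eqn_pmul2r ?eidx_gt0 //.
  by rewrite eq_sym (negbTE jj).
rewrite big1 ?subr0; last first.
  by move=> j _; case: eqP => // es; rewrite /side_coef -es (negbTE hs) andbF.
case: (eqVneq (a s) 0) => [->|as0]; first exact: Pgt0.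
rewrite Pgt_nz // (glt_subgl oC) /glt (augment_le oC) // andTb.
by move: hs; rewrite /on_side as0 eq_sym.
Qed.

(** [Pu] and [Ph] are parameters so that all [j] share them. For a point of the side the degrees of
    the three powers of pi_r add up to 0, whence [Pu * Pn * Ph ^+ j] is 1 up to positive value. *)
Lemma residual_term u Pu Ph j :
  represents C mu u (pipow C r u) Pu -> u = nu (a s0) ->
  represents C mu (- hbig C r) (pipow C r (- hbig C r)) Ph ->
  exists x, homogeneous C mu (nth (gzero K G) (Rres C r f) j) 0 x /\
    Pgt C mu M (side_coef j * p ^+ (s0 + j * e) - p ^+ s0 * Pu * (x * (p ^+ e * Ph) ^+ j)).
Proof.
move=> ru eu rh; set d := ((s1 - s0) %/ e)%N.
(* Covers both indices beyond the degree, where [nth] returns its default, and points off the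
   polygon: both sides then contribute 0. *)
have zero : ~~ ((j <= d)%N && on_side C r f (s0 + j * e)) ->
    nth (gzero K G) (Rres C r f) j = gzero K G -> exists x,
    homogeneous C mu (nth (gzero K G) (Rres C r f) j) 0 x /\
    Pgt C mu M (side_coef j * p ^+ (s0 + j * e) - p ^+ s0 * Pu * (x * (p ^+ e * Ph) ^+ j)).
  move=> hn ->; exists 0; split; first exact: homogeneous_zero.
  by rewrite /side_coef (negbTE hn) !(mul0r, mulr0) subrr Pgt0.
rewrite /Rres (sL_eq setup f0) (sR_eq setup f0) -/d in zero *.
case: (leqP j d) => hj; last first.
  by apply: zero; [rewrite leqNgt hj | rewrite nth_default // size_map size_iota].
rewrite (nth_map 0%N) ?size_iota // nth_iota // add0n in zero *.
rewrite /Rcoef (sL_eq setup f0) in zero *; set s := (s0 + j * e)%N in zero *.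
case: excluded_middle_informative => [[as0 hN]|hN] in zero *; last first.
  apply: zero => //; rewrite hj /=; apply/negP => hs; apply: hN.
  have [as0 _] := andP hs; split => //.
  exact: (proj2 (onN_on_side (setup := setup) (f0 := f0) (side_index_le hj) as0) hs).
have hs : on_side C r f s := proj1 (onN_on_side (setup := setup) (f0 := f0) (side_index_le hj) as0) hN.
have [h0 _] := side_leftP setup f0; have e0 := on_side_value h0; have es := on_side_value hs.
have evu : nu (a s) = u - hbig C r *+ j.
  apply: (addIr (s%:R *: gam C r)); rewrite es -e0 -eu !scaler_nat.
  by rewrite /s mulrnDr -addrA [- _ + _]addrCA /hbig -mulrnA [(e * j)%N]mulnC addNr addr0.
have enu : u + - nu (a s) + (- hbig C r) *+ j = 0.
  by rewrite evu opprB addrCA subrr addr0 mulNrn subrr.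
have hu : GamIdx C r u by rewrite eu; apply: side_left_GamIdx.
have hnu : GamIdx C r (- nu (a s)).
  apply: GamIdxN; rewrite evu pmulrn; apply: GamIdxD => //; apply: GamIdxN.
  exact/GamIdx_mulrz/hbig_GamIdx.
have [Pn rn _] := has_unit_rep_pipow setup hnu.
have va : mu (a s) = nu (a s) by apply: (muc_small setup) => //; apply: size_coefs.
exists (Pn * a s); split.
  have := homogeneous_mul oC muV (homogeneous_Hfrac oC muV rn) (homogeneous_Hmu oC mu as0).
  by rewrite va addNr.
have hrep := represents_mul oC muV (represents_mul oC muV ru rn) (represents_exp oC muV j rh).
rewrite enu (pipow_relation setup hu hnu (GamIdxN hbig_GamIdx) enu) in hrep.
have := represents_any oC muV (g := 1) (h := 1) hrep (oner_neq0 _).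
rewrite tofrac1 divr1 mulr1 (valuation1 muV) addr0 => /(_ erefl) hP.
have p0 := phi_neq0 p1.
have -> : side_coef j = a s by rewrite /side_coef -/s hj hs.
(* Factors out the term itself, of value exactly mu(f), and leaves an error of positive value. *)
have -> : a s * p ^+ s - p ^+ s0 * Pu * (Pn * a s * (p ^+ e * Ph) ^+ j) =
    (a s * p ^+ s) * - (Pu * Pn * Ph ^+ j - 1).
  rewrite [in LHS]exprMn -exprM [(e * j)%N]mulnC [in p ^+ s]/s exprD.
  by move: (a s) (p ^+ s0) (p ^+ (j * e)) (Ph ^+ j) => A X Y Z; ring.
have vM : mu (a s * p ^+ s) = M.
  by rewrite (valuationM muV) ?expf_neq0 // (valuationX muV) // (muc_phi setup) // va -scaler_nat.
rewrite -[X in Pgt _ _ X _]addr0 -{1}vM; apply: (PgtMr oC muV); first exact: Pge_refl.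
by rewrite (PgtN muV).
Qed.

End Residual.

Theorem mainTheorem9 (K : fieldType) (G : lmodType rat) (C : chain K G) (r : nat) :
  MacLane_setup C r ->
  forall f : {poly K}, f != 0 ->
    (* f is mu-attainable: mu(f) in Gamma_r *)
    GamIdx C r.+1 (muc C r.+1 f) ->
    (* u_r(f) in Gamma_{r-1} *)
    GamIdx C r (uL C r f) /\
    (* H_mu(f) = x_r^{s_r(f)} p_r^{u_r(f)} R_r(f)(y_r) in G_mu *)
    greq C (muc C r.+1) (Hmu (muc C r.+1) f)
      (gmul (gmul (gexp (xr C r) (sL C r f)) (pr C r (uL C r f)))
            (Reval (Rres C r f) (yr C r))).
Proof.
move=> setup f f0 fatt; have oC := setup_order setup.
have muV := muc_valuation setup (leqnn r).
have hu := side_left_GamIdx setup f0 fatt.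
rewrite (uL_eq setup f0) (sL_eq setup f0); split=> //.
set u := muc C r _ in hu *; set s0 := side_left setup f0.
have [Pu ru _] := has_unit_rep_pipow setup hu.
have [Ph rh _] := has_unit_rep_pipow setup (GamIdxN (hbig_GamIdx setup)).
have p0 := phi_chain_neq0 setup (leqnn r).
have vp := muc_phi setup (leqnn r).
have hx : homogeneous C (muc C r.+1) (gexp (xr C r) s0) (gam C r *+ s0) (phi C r ^+ s0).
  by apply: homogeneous_exp => //; rewrite -vp; apply: homogeneous_Hmu.
have hp : homogeneous C (muc C r.+1) (pr C r u) u Pu by apply: homogeneous_Hfrac.
have hy : homogeneous C (muc C r.+1) (yr C r) 0 (phi C r ^+ eidx C r * Ph).
  apply: homogeneous_Hfrac => //.
  have := represents_tofrac C (muc C r.+1) p0; rewrite vp => /(represents_exp oC muV (eidx C r)) rp.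
  by have := represents_mul oC muV rp rh; rewrite subrr.
pose P j x := homogeneous C (muc C r.+1) (nth (gzero K G) (Rres C r f) j) 0 x /\
  Pgt C (muc C r.+1) (muc C r.+1 f) (side_coef setup f0 j * phi C r ^+ (s0 + j * eidx C r)
    - phi C r ^+ s0 * Pu * (x * (phi C r ^+ eidx C r * Ph) ^+ j)).
(* Fixes one representative per coefficient, so that the evaluated residual polynomial is followed
   by a single polynomial. *)
pose x j := epsilon (inhabits (0 : {poly K})) (P j).
have hP j : P j (x j) by apply: epsilon_spec; apply: residual_term ru erefl rh.
have hR : homogeneous C (muc C r.+1) (Reval (Rres C r f) (yr C r)) 0
    (\sum_(j <- iota 0 (size (Rres C r f))) x j * (phi C r ^+ eidx C r * Ph) ^+ j).
  apply: homogeneous_sum => // j; have [hj _] := hP j.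
  by have := homogeneous_mul oC muV hj (homogeneous_exp oC muV j hy); rewrite mul0rn addr0.
have [hs0 _] := side_leftP setup f0.
have hM : gam C r *+ s0 + u + 0 = muc C r.+1 f.
  by have := on_side_value hs0; rewrite scaler_nat addr0 addrC.
have := homogeneous_mul oC muV (homogeneous_mul oC muV hx hp) hR; rewrite hM => hRHS.
apply: (homogeneous_greq oC muV (homogeneous_Hmu oC _ f0) hRHS).
rewrite /Rres size_map size_iota (sL_eq setup f0) (sR_eq setup f0) -/s0.
set X := _ * \sum_(j <- _) _.
(* With the terms of [f] off the side discarded, both polynomials are sums over the same [j] and are
   compared term by term. *)
suff hX : Pgt C (muc C r.+1) (muc C r.+1 f)
    (\sum_(j <- iota 0 ((side_right setup f0 - s0) %/ eidx C r).+1)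
       side_coef setup f0 j * phi C r ^+ (s0 + j * eidx C r) - X).
  by have := PgtD oC muV (side_coefs_close setup f0) hX; rewrite addrA subrK.
rewrite /X mulr_sumr -sumrB; apply: Pgt_sum => // j _.
by have [_] := hP j.
Qed.
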